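(* Let $\Omega\subset\mathbb R^d$ be a domain of Poincaré type. Assume that the operator-valued function $C:\Omega\to\mathcal L(\ell^2(\mathbb N))$ is of class $C(\overline\Omega)$, uniformly bounded and accretive. Let $V:=\bigoplus_{i\in\mathbb N}H^1_0(\Omega)$ and $$a(\psi,\psi'):=\int_\Omega (C(x)\nabla\psi(x)\mid\nabla\psi'(x))\,dx,\qquad \psi,\psi'\in V.$$ Then the form $(a,V)$ is coercive if and only if the operator family $C=\{C(x):x\in\Omega\}$ is uniformly coercive.
   Context: $V=\bigoplus_{i\in\mathbb N}H_0^1(\Omega)$ is the Hilbert space direct sum (square-summable sequences $\psi=(\psi_i)_{i}$, $\|\psi\|_V^2=\sum_i\|\psi_i\|^2_{H^1(\Omega)}$). $C(x)$ acts on the sequence index only, that is $(C(x)\nabla\psi(x)\mid\nabla\psi'(x))=\sum_{k=1}^d\big(C(x)\partial_k\psi(x)\mid\partial_k\psi'(x)\big)_{\ell^2(\mathbb N)}$, where $\partial_k\psi(x)=(\partial_k\psi_i(x))_{i\in\mathbb N}$. $\Omega$ is of Poincaré type if $(u,v)\mapsto(\nabla u\mid\nabla v)_{L^2(\Omega)}$ is a scalar product inducing an equivalent norm on $H_0^1(\Omega)$. $C$ of class $C(\overline\Omega)$ means that $C$ is a continuous function on $\overline\Omega$ with values in $\mathcal L(\ell^2(\mathbb N))$ (operator norm). $C$ is accretive if $\mathrm{Re}(C(x)y\mid y)\ge 0$ for all $x\in\Omega$, $y\in\ell^2(\mathbb N)$, and uniformly coercive if there is $\alpha>0$ with $\mathrm{Re}(C(x)y\mid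 y)\ge\alpha\|y\|^2_{\ell^2}$ for all $x\in\Omega$, $y\in\ell^2(\mathbb N)$. The form $(a,V)$ is coercive if there is $\alpha>0$ with $\mathrm{Re}\,a(\psi,\psi)\ge\alpha\|\psi\|_V^2$ for all $\psi\in V$. *)

(* Defs.v *)
From HB Require Import structures.
From mathcomp Require Import all_boot all_order all_algebra.
From mathcomp Require Import all_classical all_reals all_analysis.
From mathcomp Require Import complex ring lra.
Set Implicit Arguments.
Unset Strict Implicit.
Unset Printing Implicit Defensive.
Import Order.TTheory GRing.Theory Num.Theory.
Import numFieldNormedType.Exports.
Local Open Scope classical_set_scope.
Local Open Scope complex_scope.
Local Open Scope ring_scope.

Definition measure_rV_display : measure_display.
Proof. exact: default_measure_display. Qed.

Section measurable_rV.
Context {R : realType} (d : nat).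

(* The sigma-algebra generated by the coordinates, i.e. the Borel sets of R^d;
   same construction as the library's instance on d.-tuple R. *)
Let coors : 'I_d -> 'rV[R]_d -> measurableTypeR R := fun i x => x 0 i.

Let rV_set0 : g_sigma_preimage coors set0.
Proof. exact: sigma_algebra0. Qed.

Let rV_setC A : g_sigma_preimage coors A -> g_sigma_preimage coors (~` A).
Proof. exact: sigma_algebraC. Qed.

Let rV_bigcup (F : _^nat) : (forall i, g_sigma_preimage coors (F i)) ->
  g_sigma_preimage coors (\bigcup_i (F i)).
Proof. exact: sigma_algebra_bigcup. Qed.

HB.instance Definition _ := @isMeasurable.Build measure_rV_display
  'rV[R]_d (g_sigma_preimage coors) rV_set0 rV_setC rV_bigcup.

Lemma measurable_fun_rVP d1 (T1 : measurableType d1) (f : T1 -> 'rV[R]_d) :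
  (forall i : 'I_d, measurable_fun setT (fun x => f x 0 i : measurableTypeR R)) ->
  measurable_fun setT f.
Proof.
move=> mf.
suff H : g_sigma_preimage (fun i => coors i \o f) `<=` measurable.
  move: H; rewrite g_sigma_preimage_comp => H _ A mA.
  by apply: H; exists A.
apply: smallest_sub; first exact: sigma_algebra_measurable.
rewrite -bigcup_seq => A [i /= _] [B mB <-]; exact: mf.
Qed.

Lemma measurable_coord (i : 'I_d) :
  measurable_fun setT (fun x : 'rV[R]_d => x 0 i : measurableTypeR R).
Proof.
move=> _ Y mY; rewrite setTI; apply: sub_sigma_algebra => /=.
rewrite -bigcup_seq/=; exists i => /=; first by rewrite mem_index_enum.
by exists Y => //; rewrite setTI.
Qed.

End measurable_rV.

Definition cons_rV {R : realType} n (p : measurableTypeR R * 'rV[R]_n)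
  : 'rV[R]_n.+1 := row_mx (p.1%:M : 'rV[R]_1) p.2.

Fixpoint lebesgue_rV {R : realType} d : set 'rV[R]_d -> \bar R :=
  if d is n.+1 return set 'rV[R]_d -> \bar R
  then pushforward (lebesgue_measure \x @lebesgue_rV R n)%E (@cons_rV R n)
  else \d_(0 : 'rV[R]_0).

Section lebesgue_rV_measure.
Context {R : realType}.

Lemma measurable_cons_rV n : measurable_fun setT (@cons_rV R n).
Proof.
apply: measurable_fun_rVP => i.
case: (split_ordP (i : 'I_(1 + n))) => j ij.
  rewrite (_ : (fun _ => _) = fst); first exact: measurable_fst.
  apply/funext => p; rewrite /cons_rV ij.
  rewrite (@row_mxEl _ 1 1 n) (ord1 j) mxE eqxx mulr1n //.
rewrite (_ : (fun _ => _) = (fun x : 'rV[R]_n => x 0 j : measurableTypeR R) \o snd).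
  apply: measurableT_comp; first exact: measurable_coord.
  exact: measurable_snd.
by apply/funext => p; rewrite /cons_rV ij (@row_mxEr _ 1 1 n).
Qed.

Lemma measurable_uncons n : measurable_fun setT
  (fun x : 'rV[R]_n.+1 =>
     (x 0 0 : measurableTypeR R, \row_(j < n) x 0 (lift 0 j))).
Proof.
apply/measurable_fun_pairP; split; first exact: measurable_coord.
apply: measurable_fun_rVP => i /=.
rewrite (_ : (fun _ => _) = (fun x : 'rV[R]_n.+1 => x 0 (lift 0 i))).
  exact: measurable_coord.
by apply/funext => x /=; rewrite mxE.
Qed.

Section step.
Variables (n : nat) (m : {sigma_finite_measure set 'rV[R]_n -> \bar R}).

Definition lebesgue_step : set 'rV[R]_n.+1 -> \bar R :=
  pushforward (lebesgue_measure \x m)%E (@cons_rV R n).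

HB.instance Definition _ := Measure.copy lebesgue_step
  (measure_function_pushforward__canonical__measure_function_Measure
     (lebesgue_measure \x m)%E (@measurable_cons_rV n)).

Let lebesgue_step_sigma_finite : sigma_finite setT lebesgue_step.
Proof.
have /sigma_finiteP[F [TF ndF Foo]] := sigma_finiteT (@lebesgue_measure R).
have /sigma_finiteP[G [TG ndG Goo]] := sigma_finiteT m.
exists (fun k => (fun x : 'rV[R]_n.+1 =>
  (x 0 0 : measurableTypeR R, \row_(j < n) x 0 (lift 0 j))) @^-1` (F k `*` G k)).
  rewrite -preimage_bigcup (_ : \bigcup_k _ = setT) ?preimage_setT//.
  rewrite -setXTT TF TG predeqE => -[x y]; split.
    by move=> [k _ []/= ? ?]; split; exists k.
  move=> [/= [k _ Fkx] [l _ Gly]]; exists (maxn k l) => //; split.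
  - by move: x Fkx; exact/subsetPset/ndF/leq_maxl.
  - by move: y Gly; exact/subsetPset/ndG/leq_maxr.
move=> k; have [mFk Fkoo] := Foo k; have [mGk Gkoo] := Goo k; split.
  rewrite -[X in measurable X]setTI; apply: measurable_uncons => //.
  exact: measurableX.
rewrite /lebesgue_step /pushforward -comp_preimage (_ : _ \o _ = id).
  rewrite preimage_id product_measure1E// lte_mul_pinfty// ge0_fin_numE//.
apply/funext => -[a v] /=; congr pair.
  rewrite /cons_rV (_ : 0 = @lshift 1 n 0); last exact/val_inj.
  by rewrite (@row_mxEl _ 1 1 n) mxE eqxx mulr1n.
apply/rowP => j; rewrite mxE /cons_rV (_ : lift 0 j = @rshift 1 n j).
  by rewrite (@row_mxEr _ 1 1 n).
exact/val_inj.
Qed.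

HB.instance Definition _ := Measure_isSigmaFinite.Build _ _ _
  lebesgue_step lebesgue_step_sigma_finite.

End step.

Let lebesgue_rV_is_measure d :
  exists m : {sigma_finite_measure set 'rV[R]_d -> \bar R},
    m = @lebesgue_rV R d :> (set _ -> _).
Proof.
elim: d => [|n [m mE]] /=; first by exists \d_(0 : 'rV[R]_0).
by rewrite -mE; exists (lebesgue_step m).
Qed.

Let lebesgue_rV0 d : @lebesgue_rV R d set0 = 0%E.
Proof. by have [m <-] := lebesgue_rV_is_measure d; exact: measure0. Qed.

Let lebesgue_rV_ge0 d A : (0 <= @lebesgue_rV R d A)%E.
Proof. by have [m <-] := lebesgue_rV_is_measure d; exact: measure_ge0. Qed.

Let lebesgue_rV_sigma_additive d : semi_sigma_additive (@lebesgue_rV R d).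
Proof.
have [m <-] := lebesgue_rV_is_measure d.
exact: measure_semi_sigma_additive.
Qed.

HB.instance Definition _ d := isMeasure.Build _ _ _ (@lebesgue_rV R d)
  (@lebesgue_rV0 d) (@lebesgue_rV_ge0 d) (@lebesgue_rV_sigma_additive d).

Let lebesgue_rV_sigma_finite d : sigma_finite setT (@lebesgue_rV R d).
Proof.
have [m mE] := lebesgue_rV_is_measure d.
by rewrite -mE; exact: (sigma_finiteT m).
Qed.

HB.instance Definition _ d := Measure_isSigmaFinite.Build _ _ _
  (@lebesgue_rV R d) (@lebesgue_rV_sigma_finite d).

End lebesgue_rV_measure.

Section complex_valued.
Context {R : realType}.
Implicit Types (f : nat -> R[i]).

Definition sqnorm (z : R[i]) : R := Normc.normc z ^+ 2.

Definition cseries f : R[i] :=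
  limn (series (fun n => complex.Re (f n))) +i*
  limn (series (fun n => complex.Im (f n))).

Definition measurable_cfun d (T : measurableType d) (D : set T)
    (u : T -> R[i]) : Prop :=
  measurable_fun D (fun x => complex.Re (u x)) /\
  measurable_fun D (fun x => complex.Im (u x)).

Definition cintegral d (T : measurableType d)
    (mu : {measure set T -> \bar R}) (D : set T) (u : T -> R[i]) : R[i] :=
  (\int[mu]_(x in D) complex.Re (u x)) +i*
  (\int[mu]_(x in D) complex.Im (u x)).

End complex_valued.

Section ell2.
Context {R : realType}.

Definition ell2_pred : {pred (nat -> R[i])} :=
  fun y => `[< (\sum_(0 <= i <oo) (sqnorm (y i))%:E < +oo)%E >].

Lemma sqnormE (z : R[i]) : sqnorm z = complex.Re z ^+ 2 + complex.Im z ^+ 2.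
Proof. by case: z => a b; rewrite /sqnorm /= sqr_sqrtr// addr_ge0// sqr_ge0. Qed.

Lemma sqnorm_ge0 (z : R[i]) : 0 <= sqnorm z.
Proof. by rewrite sqnormE addr_ge0// sqr_ge0. Qed.

Lemma sqnormD (a z w : R[i]) :
  sqnorm (a * z + w) <= 2 * sqnorm a * sqnorm z + 2 * sqnorm w.
Proof.
rewrite !sqnormE; case: a z w => [a b] [c d] [e f] /=.
rewrite -subr_ge0 (_ : _ - _ =
  (a * c - b * d - e) ^+ 2 + (a * d + b * c - f) ^+ 2); last by ring.
by rewrite addr_ge0// sqr_ge0.
Qed.

Lemma ell2_submod_closed : submod_closed ell2_pred.
Proof.
split=> [|a y z /asboolP yl2 /asboolP zl2]; apply/asboolP.
  rewrite eseries0// => i _ _.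
  by rewrite sqnormE /= expr0n /= addr0.
apply: (@le_lt_trans _ _ (\sum_(0 <= i <oo)
    ((2 * sqnorm a)%:E * (sqnorm (y i))%:E + 2%:E * (sqnorm (z i))%:E))%E).
  apply: lee_nneseries => [i _ _|i _]; first by rewrite lee_fin sqnorm_ge0.
  by rewrite -!EFinM -EFinD lee_fin; exact: sqnormD.
have ge0M (c : R) (v : nat -> R[i]) i : 0 <= c ->
  (0 <= c%:E * (sqnorm (v i))%:E)%E.
  by move=> c0; rewrite -EFinM lee_fin mulr_ge0// sqnorm_ge0.
rewrite nneseriesD => [|i _ _|i _ _]; last 2 first.
- by apply: ge0M; rewrite mulr_ge0// sqnorm_ge0.
- exact: ge0M.
have sq0 (v : nat -> R[i]) i : (0 <= (sqnorm (v i))%:E)%E.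
  by rewrite lee_fin sqnorm_ge0.
rewrite !nneseriesZl//; try by move=> i _; exact: sq0.
have a0 : 0 <= 2 * sqnorm a by rewrite mulr_ge0// sqnorm_ge0.
rewrite lte_add_pinfty// lte_mul_pinfty//.
Qed.

HB.instance Definition _ := GRing.isSubmodClosed.Build _ _ ell2_pred
  ell2_submod_closed.

Record ell2 := Ell2 {ell2_val :> nat -> R[i]; _ : ell2_val \in ell2_pred}.
HB.instance Definition _ := [isSub for ell2_val].
HB.instance Definition _ := [Choice of ell2 by <:].
HB.instance Definition _ := [SubChoice_isSubLmodule of ell2 by <:].

(* The inner product is linear in the first variable. *)
Definition ell2_dot (y z : ell2) : R[i] := cseries (fun i => y i * (z i)^*).

Definition ell2_norm (y : ell2) : R :=
  Num.sqrt (fine (\sum_(0 <= i <oo) (sqnorm (y i))%:E)%E).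

Definition opnorm (T : ell2 -> ell2) : \bar R :=
  ereal_sup [set (ell2_norm (T y))%:E | y in [set y | ell2_norm y <= 1]].

End ell2.
Arguments ell2 : clear implicits.

Section smooth.
Context {R : realType} {d : nat}.
Implicit Types (f : 'rV[R]_d -> R) (k : 'I_d).

Definition partial k f : 'rV[R]_d -> R := fun x => 'D_(delta_mx 0 k) f x.

(* Class C^oo: all iterated partial derivatives exist and are continuous. *)
Definition smooth f : Prop := forall s : seq 'I_d,
  continuous (foldr partial f s) /\
  forall k x, derivable (foldr partial f s) x (delta_mx 0 k).

Definition cpartial k (phi : 'rV[R]_d -> R[i]) : 'rV[R]_d -> R[i] := fun x =>
  partial k (fun y => complex.Re (phi y)) x +i*
  partial k (fun y => complex.Im (phi y)) x.

End smooth.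

Definition is_scalar_product {R : realType} (E : lmodType R[i]) (D : set E)
    (null : E -> Prop) (s : E -> E -> R[i]) : Prop :=
  [/\ forall a u v w, D u -> D v -> D w ->
        s (a *: u + v) w = a * s u w + s v w,
      forall u v, D u -> D v -> s v u = (s u v)^*,
      forall u, D u -> 0 <= s u u &
      forall u, D u -> s u u = 0 -> null u].

Section sobolev.
Context {R : realType} {d : nat} (Omega : set 'rV[R]_d).
Local Notation mu := (@lebesgue_rV R d).

Definition is_domain : Prop := [/\ Omega !=set0, open Omega & connected Omega].

(* C_c^oo(Omega; C), each function being extended by 0 to the whole space. *)
Definition test_function (phi : 'rV[R]_d -> R[i]) : Prop :=
  [/\ smooth (fun x => complex.Re (phi x)),
      smooth (fun x => complex.Im (phi x)) &
      exists K, [/\ compact K, K `<=` Omega & forall x, ~ K x -> phi x = 0]].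

Definition L2_sqnorm (u : 'rV[R]_d -> R[i]) : \bar R :=
  (\int[mu]_(x in Omega) (sqnorm (u x))%:E)%E.

(* Representatives are Borel; every Lebesgue class has one. *)
Definition in_L2 (u : 'rV[R]_d -> R[i]) : Prop :=
  measurable_cfun Omega u /\ (L2_sqnorm u < +oo)%E.

Definition weak_partial (k : 'I_d) (u g : 'rV[R]_d -> R[i]) : Prop :=
  forall phi, test_function phi ->
    cintegral mu Omega (fun x => u x * cpartial k phi x) =
    - cintegral mu Omega (fun x => g x * phi x).

(* An element of H^1 is carried as a pair: a representative u of the function
   and, for each k, a representative of its k-th weak derivative (which is
   determined by u up to a null set). *)
Definition with_grad : Type :=
  (('rV[R]_d -> R[i]) * ('I_d -> 'rV[R]_d -> R[i]))%type.

HB.instance Definition _ := GRing.Lmodule.on with_grad.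

Implicit Types u v : with_grad.

Definition in_H1 u : Prop :=
  in_L2 u.1 /\ forall k, in_L2 (u.2 k) /\ weak_partial k u.1 (u.2 k).

Definition H1_sqnorm u : \bar R :=
  (L2_sqnorm u.1 + \sum_(k < d) L2_sqnorm (u.2 k))%E.

(* H^1_0 is the closure of the test functions in H^1. *)
Definition in_H10 u : Prop := in_H1 u /\
  forall e : R, 0 < e -> exists2 phi, test_function phi &
    (H1_sqnorm (u - ((phi, fun k => cpartial k phi) : with_grad))%R < e%:E)%E.

Definition grad_dot u v : R[i] :=
  \sum_(k < d) cintegral mu Omega (fun x => u.2 k x * (v.2 k x)^*).

(* Equivalence of the norms is expressed on their squares. *)
Definition poincare_type : Prop :=
  is_scalar_product in_H10
    (fun u => {ae mu, forall x, Omega x -> u.1 x = 0}) grad_dot /\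
  exists c1 c2 : R, [/\ 0 < c1, 0 < c2 & forall u, in_H10 u ->
    (c1%:E * H1_sqnorm u <= (complex.Re (grad_dot u u))%:E <=
     c2%:E * H1_sqnorm u)%E].

Implicit Types psi : nat -> with_grad.

Definition V_sqnorm psi : \bar R := (\sum_(0 <= i <oo) H1_sqnorm (psi i))%E.

Definition in_V psi : Prop :=
  (forall i, in_H10 (psi i)) /\ (V_sqnorm psi < +oo)%E.

Definition coercive_form (a : (nat -> with_grad) -> (nat -> with_grad) -> R[i])
    : Prop :=
  exists2 alpha : R, 0 < alpha & forall psi, in_V psi ->
    (alpha%:E * V_sqnorm psi <= (complex.Re (a psi psi))%:E)%E.

(* For psi in V the sequence (d_k psi_i(x))_i is in ell2 for almost every x in
   Omega; insubd replaces it by 0 on the exceptional null set. *)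
Definition V_partial (k : 'I_d) psi (x : 'rV[R]_d) : ell2 R :=
  insubd (0 : ell2 R) (fun i => (psi i).2 k x).

(* C(x) is only meaningful for x in the closure of Omega. *)
Variable C : 'rV[R]_d -> {linear ell2 R -> ell2 R}.

Definition V_form psi psi' : R[i] :=
  cintegral mu Omega (fun x => \sum_(k < d)
    ell2_dot (C x (V_partial k psi x)) (V_partial k psi' x)).

Definition class_C_closure : Prop :=
  (forall x, closure Omega x -> (opnorm (C x) < +oo)%E) /\
  forall x, closure Omega x ->
    opnorm (fun y => C x' y - C x y)
      @[x' --> within (closure Omega) (nbhs x)] --> 0%E.

Definition uniformly_bounded : Prop :=
  exists M : R, forall x, Omega x -> (opnorm (C x) <= M%:E)%E.

Definition accretive : Prop :=
  forall x y, Omega x -> 0 <= complex.Re (ell2_dot (C x y) y).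

Definition uniformly_coercive : Prop :=
  exists2 alpha : R, 0 < alpha & forall x y, Omega x ->
    alpha * ell2_norm y ^+ 2 <= complex.Re (ell2_dot (C x y) y).

End sobolev.

(* Main.v *)
Require Import Defs.
From HB Require Import structures.
From mathcomp Require Import all_boot all_order all_algebra.
From mathcomp Require Import all_classical all_reals all_analysis.
From mathcomp Require Import measurable_realfun complex ring lra.
Set Implicit Arguments.
Unset Strict Implicit.
Unset Printing Implicit Defensive.
Import Order.TTheory GRing.Theory Num.Theory.
Import numFieldNormedType.Exports.
Local Open Scope classical_set_scope.
Local Open Scope ring_scope.

(** Both directions rest on reading the form as an integral of the pointwise
    numerical forms Re (C(x) y | y), tested against gradients.

    If C is uniformly coercive with constant alpha, integrating the pointwise
    bound gives Re a(psi, psi) >= alpha * sum_i ||grad psi_i||^2, and the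
    Poincare inequality, applied to each component, turns the right-hand side
    into a multiple of ||psi||_V^2
    ([coercive_form_of_uniformly_coercive]).  The upper bound on C only serves
    to know that the integral defining a(psi, psi) is finite.

    Conversely, fix x0 in Omega and y in ell2, and let f be a smooth bump
    function supported in a small neighbourhood of x0.  For the elementary
    tensor psi_i = y_i f the form factorizes:
      Re a(psi, psi) = int |grad f|^2 Re (C(x) y | y) dx,
    while ||psi||_V^2 >= ||y||^2 int |grad f|^2.  By continuity of C at x0 the
    factor Re (C(x) y | y) is at most Re (C(x0) y | y) + eps ||y||^2 on the
    support of f, so coercivity of the form with constant alpha gives
      alpha ||y||^2 int |grad f|^2
        <= (Re (C(x0) y | y) + eps ||y||^2) int |grad f|^2.
    The Poincare inequality guarantees that int |grad f|^2 > 0 (in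
    dimension 0 it just cannot hold), so this factor can be cancelled; taking
    eps = alpha / 2 gives uniform coercivity with constant alpha / 2
    ([uniformly_coercive_of_coercive_form]).

    The second direction needs two constructions in R^d.  Test functions must
    be shown to lie in H^1_0, that is, their classical partial derivatives
    must be weak derivatives; this is integration by parts, which reduces to
    the vanishing of the integral of a partial derivative of a compactly
    supported function ([integral_partial_eq0]).  And bump functions must
    exist ([bump_exists]). *)

(** * The Hilbert space ell2 *)

Section ell2_theory.
Context {R : realType}.
Implicit Types (y u v w : ell2 R).
Local Open Scope complex_scope.

Let seriesZ_cvg (f : R^nat) k :
  cvgn (series f) -> cvgn (series (fun i => k * f i)).
Proof. exact: is_cvg_seriesZ. Qed.

Let seriesZ_lim (f : R^nat) k : cvgn (series f) ->
  k * limn (series f) = limn (series (fun i => k * f i)).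
Proof. by move=> cf; rewrite -[LHS](lim_seriesZ k cf). Qed.

Let seriesD_cvg (f g : R^nat) : cvgn (series f) -> cvgn (series g) ->
  cvgn (series (fun i => f i + g i)).
Proof. exact: is_cvg_seriesD. Qed.

Let seriesD_lim (f g : R^nat) : cvgn (series f) -> cvgn (series g) ->
  limn (series f) + limn (series g) = limn (series (fun i => f i + g i)).
Proof. by move=> cf cg; rewrite -[LHS](lim_seriesD cf cg). Qed.

Lemma ell2_lty y : (\sum_(0 <= i <oo) (sqnorm (y i))%:E < +oo)%E.
Proof. by case: y => y /= /asboolP. Qed.

Lemma ell2_cvg y : cvgn (series (fun i => sqnorm (y i))).
Proof. by apply: nnseries_is_cvg => [i|]; [exact: sqnorm_ge0|exact: ell2_lty]. Qed.

Lemma sqr_ell2_norm y :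
  (ell2_norm y ^+ 2)%:E = (\sum_(0 <= i <oo) (sqnorm (y i))%:E)%E.
Proof.
have y0 : (0 <= \sum_(0 <= i <oo) (sqnorm (y i))%:E)%E.
  by apply: nneseries_ge0 => i _ _; rewrite lee_fin sqnorm_ge0.
rewrite /ell2_norm sqr_sqrtr ?fine_ge0// fineK// ge0_fin_numE//.
exact: ell2_lty.
Qed.

Lemma sqr_ell2_normE y :
  ell2_norm y ^+ 2 = limn (series (fun i => sqnorm (y i))).
Proof.
apply: EFin_inj; rewrite sqr_ell2_norm -EFin_lim; last exact: ell2_cvg.
by congr (limn _); apply/funext => n /=; rewrite /series /= sumEFin.
Qed.

Lemma ell2_norm_ge0 y : 0 <= ell2_norm y.
Proof. exact: sqrtr_ge0. Qed.

Lemma Re_mul_conj (z w : R[i]) :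
  complex.Re (z * w^*) = complex.Re z * complex.Re w + complex.Im z * complex.Im w.
Proof. by case: z w => a b [c e] /=; ring. Qed.

(** Young's inequality, with a weight t to be balanced later. *)
Lemma Re_mul_conj_le (t : R) (z w : R[i]) : 0 < t ->
  `|complex.Re (z * w^*)| <= (2 * t)^-1 * sqnorm z + t / 2 * sqnorm w.
Proof.
move=> t0; rewrite Re_mul_conj !sqnormE; case: z w => [a b] [c e] /=.
have H s : s ^+ 2 = 1 -> s * (a * c + b * e) <=
    (2 * t)^-1 * (a ^+ 2 + b ^+ 2) + t / 2 * (c ^+ 2 + e ^+ 2).
  move=> s1; rewrite -subr_ge0.
  have -> : (2 * t)^-1 * (a ^+ 2 + b ^+ 2) + t / 2 * (c ^+ 2 + e ^+ 2) -
    s * (a * c + b * e) =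
    (2 * t)^-1 * ((a - s * t * c) ^+ 2 + (b - s * t * e) ^+ 2) +
     t / 2 * (1 - s ^+ 2) * (c ^+ 2 + e ^+ 2) by field; rewrite gt_eqF.
  rewrite s1 subrr mulr0 mul0r addr0 mulr_ge0 ?addr_ge0 ?sqr_ge0//.
  by rewrite invr_ge0 mulr_ge0// ltW.
rewrite ler_norml; apply/andP; split.
  by rewrite lerNl -mulN1r H// sqrrN expr1n.
by rewrite -[X in X <= _]mul1r H// expr1n.
Qed.

(** Young's inequality dominates the terms by those of the two convergent series
    of squares. *)
Lemma ell2_dot_cvg u v :
  cvgn (series (fun i => complex.Re (u i * (v i)^*))).
Proof.
apply: normed_cvg.
apply: (@series_le_cvg _ _ (fun i => (2 * 1)^-1 * sqnorm (u i) + 1 / 2 * sqnorm (v i))).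
- by move=> i /=.
- by move=> i; rewrite addr_ge0// mulr_ge0// sqnorm_ge0.
- by move=> i; exact: Re_mul_conj_le.
- by apply: seriesD_cvg; apply: seriesZ_cvg; exact: ell2_cvg.
Qed.

Lemma Re_ell2_dot u v : complex.Re (ell2_dot u v) =
  limn (series (fun i => complex.Re (u i * (v i)^*))).
Proof. by []. Qed.

Lemma Re_ell2_dotB u v w : complex.Re (ell2_dot (u - v) w) =
  complex.Re (ell2_dot u w) - complex.Re (ell2_dot v w).
Proof.
rewrite !Re_ell2_dot.
rewrite -lim_seriesB; [|exact: ell2_dot_cvg|exact: ell2_dot_cvg].
congr (limn (series _)); apply/funext => i.
by rewrite mulrBl raddfB.
Qed.

Lemma Re_ell2_dotZ (a : R) u v :
  complex.Re (ell2_dot (a%:C *: u) (a%:C *: v)) =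
  a ^+ 2 * complex.Re (ell2_dot u v).
Proof.
rewrite !Re_ell2_dot seriesZ_lim //; last exact: ell2_dot_cvg.
congr (limn (series _)); apply/funext => i.
change (complex.Re (a%:C * u i * (a%:C * v i)^*) =
   a ^+ 2 * complex.Re (u i * (v i)^*)).
by case: (u i) (v i) => [p q] [r s] /=; ring.
Qed.

Lemma ell2_normZ (a : R) y : ell2_norm (a%:C *: y) = `|a| * ell2_norm y.
Proof.
apply/eqP; rewrite -(@eqrXn2 _ 2)// ?mulr_ge0 ?ell2_norm_ge0//.
rewrite exprMn real_normK ?num_real// !sqr_ell2_normE.
rewrite seriesZ_lim; last exact: ell2_cvg.
apply/eqP; congr (limn (series _)); apply/funext => i.
change (sqnorm (a%:C * y i) = a ^+ 2 * sqnorm (y i)).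
by rewrite !sqnormE; case: (y i) => p q /=; ring.
Qed.

(** A Cauchy-Schwarz bound, obtained by summing Young's inequality with the
    weight e that balances its two terms. *)
Lemma Re_ell2_dot_le (e : R) u y : 0 < e -> ell2_norm u <= e * ell2_norm y ->
  complex.Re (ell2_dot u y) <= e * ell2_norm y ^+ 2.
Proof.
move=> e0 uy.
apply: (@le_trans _ _ ((2 * e)^-1 * ell2_norm u ^+ 2 + e / 2 * ell2_norm y ^+ 2)).
  rewrite Re_ell2_dot !sqr_ell2_normE.
  rewrite !seriesZ_lim; try exact: ell2_cvg.
  rewrite seriesD_lim; try by apply: seriesZ_cvg; exact: ell2_cvg.
  apply: lim_series_le.
  - exact: ell2_dot_cvg.
  - by apply: seriesD_cvg; apply: seriesZ_cvg; exact: ell2_cvg.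
  - by move=> i; apply: le_trans (ler_norm _) _; exact: Re_mul_conj_le.
have u2 : ell2_norm u ^+ 2 <= e ^+ 2 * ell2_norm y ^+ 2.
  by rewrite -exprMn lerXn2r// nnegrE ?mulr_ge0 ?ell2_norm_ge0// ltW.
have -> : e * ell2_norm y ^+ 2 =
    (2 * e)^-1 * (e ^+ 2 * ell2_norm y ^+ 2) + e / 2 * ell2_norm y ^+ 2.
  by field; rewrite gt_eqF.
by rewrite lerD2r ler_wpM2l// invr_ge0 mulr_ge0// ltW.
Qed.

(** Homogeneity for real scalars is enough to pass from the unit ball to the
    whole space; the lemma is used for C(x) and for differences C(x) - C(x0). *)
Lemma opnorm_bound (T : ell2 R -> ell2 R) (M : R) y :
  (forall (a : R) z, T (a%:C *: z) = a%:C *: T z) ->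
  (opnorm T <= M%:E)%E -> ell2_norm (T y) <= M * ell2_norm y.
Proof.
move=> TZ TM.
have T1 z : ell2_norm z <= 1 -> ell2_norm (T z) <= M.
  move=> z1; rewrite -lee_fin; apply: le_trans TM.
  by apply: ereal_sup_ubound; exists z.
have [y0|y0] := eqVneq (ell2_norm y) 0; last first.
  have yp : 0 < ell2_norm y by rewrite lt_neqAle eq_sym y0 ell2_norm_ge0.
  have := T1 ((ell2_norm y)^-1%:C *: y).
  rewrite TZ !ell2_normZ ger0_norm ?invr_ge0 ?ell2_norm_ge0// mulVf// lexx.
  by move=> /(_ isT); rewrite mulrC ler_pdivrMr.
(* A null vector stays in the unit ball under every scaling *)
rewrite y0 mulr0 leNgt; apply/negP => Ty0.
have := T1 (((`|M| + 1) / ell2_norm (T y))%:C *: y).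
rewrite TZ !ell2_normZ y0 mulr0 ler01 => /(_ isT).
rewrite ger0_norm; last by rewrite divr_ge0 ?ell2_norm_ge0 ?addr_ge0.
by rewrite divfK ?gt_eqF//; move: (ler_norm M); lra.
Qed.

End ell2_theory.

(** * Cubes, Borel sets and Lebesgue measure in R^d *)

Section euclidean_space.
Context {R : realType}.

Lemma cons_rV0 d (p : measurableTypeR R * 'rV[R]_d) : cons_rV p 0 0 = p.1.
Proof.
rewrite /cons_rV (_ : 0 = @lshift 1 d 0); last exact/val_inj.
by rewrite (@row_mxEl _ 1 1 d) mxE eqxx mulr1n.
Qed.

Lemma cons_rVS d (p : measurableTypeR R * 'rV[R]_d) j :
  cons_rV p 0 (lift 0 j) = p.2 0 j.
Proof.
rewrite /cons_rV (_ : lift 0 j = @rshift 1 d j); last exact/val_inj.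
by rewrite (@row_mxEr _ 1 1 d).
Qed.

Definition cube d (a : 'rV[R]_d) (r : R) : set 'rV[R]_d :=
  [set x | forall i, `|x 0 i - a 0 i| < r].

Lemma ball_rVE d (a : 'rV[R]_d) r : 0 < r -> ball a r = cube a r.
Proof.
move=> r0; apply/seteqP; split => x /= => [[_ H] i|H].
  by rewrite distrC; exact: H.
by split=> // i j; rewrite (ord1 i) /ball /= distrC.
Qed.

Lemma cube_nbhs d (a : 'rV[R]_d) r : 0 < r -> nbhs a (cube a r).
Proof. by move=> r0; rewrite -ball_rVE//; exact: nbhsx_ballx. Qed.

Lemma measurable_cube d (a : 'rV[R]_d) r : measurable (cube a r).
Proof.
rewrite (_ : cube a r = \bigcap_(i in [set: 'I_d])
    ((fun x : 'rV[R]_d => x 0 i : measurableTypeR R) @^-1` ball (a 0 i) r)).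
  apply: fin_bigcap_measurable => [|i _]; first exact: finite_finset.
  rewrite -[X in measurable X]setTI; apply: measurable_coord => //.
  by apply: open_measurable; exact: ball_open.
apply/seteqP; split => x /= H i; first by move=> _ /=; rewrite /ball /= distrC.
by have := H i I; rewrite /ball /= distrC.
Qed.

(** An open set is the union of the cubes with rational centre and radius of the
    form 1/n that it contains, and these are countably many. *)
Lemma open_rV_measurable d (O : set 'rV[R]_d) : open O -> measurable O.
Proof.
move=> oO.
pose F (p : 'rV[rat]_d * nat) : set 'rV[R]_d :=
  let c := cube (map_mx ratr p.1) p.2.+1%:R^-1 in
  if `[< c `<=` O >] then c else set0.
rewrite (_ : O = \bigcup_p F p).
  apply: countable_bigcupT_measurable => [|p]; first exact: countableP.
  by rewrite /F /=; case: ifP => _; [exact: measurable_cube|exact: measurable0].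
apply/seteqP; split => x; last first.
  by move=> [p _]; rewrite /F /=; case: ifP => [/asboolP cO|_ []]; exact: cO.
move=> Ox; have /nbhs_ballP[e /= e0 xeO] : nbhs x O by exact: open_nbhs_nbhs.
have [n] : exists n, 0 + n.+1%:R^-1 < e / 2 by apply: ltr_add_invr; rewrite divr_gt0.
rewrite add0r => ne.
have n0 : 0 < n.+1%:R^-1 :> R by rewrite invr_gt0.
have /choice[q qx] : forall i, exists q : rat, `|x 0 i - ratr q| < n.+1%:R^-1.
  move=> i; have [|q] := @rat_in_itvoo R (x 0 i - n.+1%:R^-1) (x 0 i + n.+1%:R^-1).
    by rewrite ltrBlDr -addrA ltrDl addr_gt0.
  rewrite in_itv /= => /andP[q1 q2]; exists q.
  by rewrite distrC ltr_distl q1 q2.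
exists (\row_i q i, n) => //; rewrite /F /= ifT.
  by move=> i; rewrite !mxE.
apply/asboolP => y xy; apply: xeO; rewrite ball_rVE// => i.
have := qx i; have := xy i; rewrite !mxE /= => yq xq.
rewrite (_ : y 0 i - x 0 i = (y 0 i - ratr (q i)) - (x 0 i - ratr (q i))); last by ring.
rewrite (le_lt_trans (ler_normB _ _))// [ltRHS]splitr.
by rewrite (lt_trans (ltrD yq xq))// ltrD.
Qed.

Lemma continuous_rV_measurable d (f : 'rV[R]_d -> R) (D : set 'rV[R]_d) :
  continuous f -> measurable_fun D f.
Proof.
move=> cf; apply: (@measurable_funS _ _ _ _ setT) => //.
apply: (@measurability _ _ 'rV[R]_d (measurableTypeR R) setT f (@RGenOpens.G R)).
  exact: RGenOpens.measurableE.
move=> _ [_ [a [b ->] <-]]; rewrite setTI; apply: open_rV_measurable.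
by move/continuousP: cf; apply; exact: interval_open.
Qed.

(** Splitting off the first coordinate turns a cube into a product of an interval
    and a cube of lower dimension. *)
Lemma lebesgue_cube d (a : 'rV[R]_d) r : 0 < r ->
  lebesgue_rV (cube a r) = ((2 * r) ^+ d)%:E.
Proof.
move=> r0; elim: d a => [|d IH] a.
  rewrite /= diracE (_ : _ \in _) ?expr0//.
  by apply/mem_set => -[].
pose b : 'rV[R]_d := \row_j a 0 (lift 0 j).
change ((lebesgue_measure \x @lebesgue_rV R d)%E (@cons_rV R d @^-1` cube a r) =
  ((2 * r) ^+ d.+1)%:E).
rewrite (_ : _ @^-1` _ = `]a 0 0 - r, a 0 0 + r[%classic `*` cube b r).
  rewrite product_measure1E//; last exact: measurable_cube.
  rewrite exprS EFinM; congr (_ * _)%E; last exact: IH.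
  apply: etrans (lebesgue_measure_itv _) _ => /=.
  by rewrite lte_fin ifT; [rewrite -EFinB; congr _%:E; ring|lra].
apply/seteqP; split => -[t v] /=.
  move=> H; split => /=.
    by have := H 0; rewrite cons_rV0 /= in_itv /= ltr_norml => /andP[? ?];
      apply/andP; split; lra.
  by move=> j; have := H (lift 0 j); rewrite cons_rVS mxE.
move=> [/= + H] i; rewrite in_itv /= => /andP[? ?].
case: (unliftP 0 i) => [j|] ->.
  by have := H j; rewrite cons_rVS mxE.
by rewrite cons_rV0 /= ltr_norml; apply/andP; split; lra.
Qed.

End euclidean_space.

(** * Integrals of partial derivatives *)

Section integration_by_parts.
Context {R : realType}.
Local Notation mu d := (@lebesgue_rV R d).

Lemma compact_sub_cube d (K : set 'rV[R]_d) : compact K ->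
  exists2 N, 0 < N & K `<=` cube 0 N.
Proof.
move=> /compact_bounded[M [_ MK]]; exists (`|M| + 2) => [|x Kx i].
  by rewrite ltr_wpDl.
have /MK/(_ x Kx) /= : M < `|M| + 1 by rewrite (le_lt_trans (ler_norm _))// ltrDl.
rewrite mxE subr0 => xM; apply: (@le_lt_trans _ _ (`|M| + 1)); last first.
  by rewrite ltrD2l ltr1n.
apply: le_trans xM; rewrite [leRHS]/Num.norm /= mx_normrE.
by rewrite (le_bigmax _ (fun ij : 'I_1 * 'I_d => `|x ij.1 ij.2|) (0, i)).
Qed.

Lemma supp_integral d (D : set 'rV[R]_d) (f : 'rV[R]_d -> \bar R) :
  (forall x, ~ D x -> f x = 0%E) ->
  (\int[mu d]_x f x = \int[mu d]_(x in D) f x)%E.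
Proof.
move=> f0; rewrite [RHS]integral_mkcond; apply: eq_integral => x _.
by rewrite patchE; case: ifPn => // /negP; rewrite inE => /f0.
Qed.

Lemma continuous_supp_bounded d (f : 'rV[R]_d -> R) (K : set 'rV[R]_d) :
  continuous f -> compact K -> (forall x, ~ K x -> f x = 0) ->
  exists M, forall x, `|f x| <= M.
Proof.
move=> cf cK f0.
have /compact_bounded[M [_ MK]] : compact (f @` K).
  by apply: continuous_compact => //; exact: continuous_subspaceT.
exists (`|M| + 1) => x; have [Kx|/f0 ->] := pselect (K x); last by rewrite normr0.
by apply: MK; [rewrite (le_lt_trans (ler_norm _))// ltrDl|exists x].
Qed.

Lemma continuous_supp_integrable d (f : 'rV[R]_d -> R) (K D : set 'rV[R]_d) :
  continuous f -> compact K -> (forall x, ~ K x -> f x = 0) -> measurable D ->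
  (mu d).-integrable D (fun x => (f x)%:E).
Proof.
move=> cf cK f0 mD; apply: (@integrableS _ _ _ _ setT) => //.
have mf : measurable_fun setT f by exact: continuous_rV_measurable.
apply/integrableP; split; first exact/measurable_EFinP.
have [N N0 KN] := compact_sub_cube cK.
have [M fM] := continuous_supp_bounded cf cK f0.
rewrite (@supp_integral _ (cube 0 N)); last first.
  by move=> x Nx; rewrite f0 ?abse0// => /KN.
apply: (@le_lt_trans _ _ (\int[mu d]_(x in cube 0 N) (cst M%:E x))%E).
  apply: ge0_le_integral => //=; first exact: measurable_cube.
  - by apply: measurable_funTS; apply/measurable_EFinP; exact: measurableT_comp.
  - by move=> x _; rewrite lee_fin.
rewrite integral_cst; last exact: measurable_cube.
by rewrite [X in (_ * X)%E](lebesgue_cube 0 N0) -EFinM ltry.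
Qed.

Lemma partial_supp d (f : 'rV[R]_d -> R) (K : set 'rV[R]_d) k :
  closed K -> (forall x, ~ K x -> f x = 0) ->
  forall x, ~ K x -> partial k f x = 0.
Proof.
move=> cK f0 x Kx; rewrite /partial.
rewrite (@near_eq_derive _ _ _ f (cst 0)); last first.
  have : nbhs x (~` K) by apply: open_nbhs_nbhs; split => //; exact: closed_openC.
  by apply: filterS => y /f0.
by rewrite derive_cst.
Qed.

Lemma integral_derive1_eq0 (F : R -> R) (N : R) :
  (forall t, derivable F t 1) -> continuous F^`()%classic ->
  (forall t, N <= `|t| -> F t = 0) ->
  (\int[lebesgue_measure]_t (F^`()%classic t)%:E = 0)%E.
Proof.
move=> dF cF F0; pose b := `|N| + 1.
have b0 : 0 < b by rewrite ltr_wpDl.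
have Nb : N < b by rewrite (le_lt_trans (ler_norm _))// ltrDl.
(* Outside [-b, b] the function vanishes in a neighbourhood of t. *)
have F'0 t : b < `|t| -> F^`()%classic t = 0.
  move=> bt; rewrite derive1E (@near_eq_derive _ _ _ F (cst 0)) ?derive_cst//.
  have : nbhs t (Num.norm @^-1` [set x : R | N < x]).
    apply: (@norm_continuous _ R^o t).
    by apply: open_nbhs_nbhs; split; [exact: open_gt|exact: lt_trans bt].
  by apply: filterS => y /= /ltW /F0.
have -> : (\int[lebesgue_measure]_t (F^`()%classic t)%:E =
    \int[lebesgue_measure]_(t in `[(- b)%R, b]) (F^`()%classic t)%:E)%E.
  rewrite [RHS]integral_mkcond; apply: eq_integral => t _.
  rewrite patchE; case: ifPn => //; rewrite mem_setE in_itv /= -ler_norml -ltNge.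
  by move=> /F'0 ->.
rewrite (continuous_FTC2 (F := F)).
- by rewrite !F0 ?subee// ?normrN gtr0_norm// ltW.
- by rewrite gtrN.
- exact: continuous_subspaceT.
- have cFt t : {for t, continuous F}.
    by apply: differentiable_continuous; exact/derivable1_diffP.
  split; first by move=> t _; exact: dF.
  + by apply: cvg_at_right_filter; exact: cFt.
  + by apply: cvg_at_left_filter; exact: cFt.
- by [].
Qed.

Lemma cons_rV_shiftS d (t h : R) (v : 'rV[R]_d) j :
  cons_rV (t, h *: delta_mx 0 j + v) =
  h *: delta_mx 0 (lift 0 j) + cons_rV (t, v) :> 'rV[R]_d.+1.
Proof.
apply/rowP => i; case: (unliftP 0 i) => [l|] ->.
  by rewrite [RHS]mxE !cons_rVS /= !mxE (inj_eq lift_inj).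
by rewrite [RHS]mxE !cons_rV0 /= !mxE /= mulr0 add0r.
Qed.

Lemma cons_rV_shift0 d (t h : R) (v : 'rV[R]_d) :
  cons_rV (h *: 1 + t, v) =
  h *: delta_mx 0 0 + cons_rV (t, v) :> 'rV[R]_d.+1.
Proof.
apply/rowP => i; case: (unliftP 0 i) => [l|] ->.
  by rewrite [RHS]mxE !cons_rVS /= !mxE /= mulr0 add0r.
by rewrite [RHS]mxE !cons_rV0 /= !mxE.
Qed.

(** Slicing off the first coordinate turns the later partial derivatives into
    partial derivatives of the slice: the difference quotients agree. *)
Lemma derive_cons_rVS d (f : 'rV[R]_d.+1 -> R) (t : R) (v : 'rV[R]_d) j :
  let g w := f (cons_rV (t, w)) in
  (derivable f (cons_rV (t, v)) (delta_mx 0 (lift 0 j)) ->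
   derivable g v (delta_mx 0 j)) /\
  partial j g v = partial (lift 0 j) f (cons_rV (t, v)).
Proof.
move=> g; have E : (fun h : R => h^-1 *: ((g \o shift v) (h *: delta_mx 0 j) - g v)) =
    (fun h => h^-1 *: ((f \o shift (cons_rV (t, v))) (h *: delta_mx 0 (lift 0 j)) -
       f (cons_rV (t, v)))).
  by apply/funext => h; rewrite /g /= cons_rV_shiftS.
by rewrite /derivable /partial /derive E.
Qed.

Lemma derive_cons_rV0 d (f : 'rV[R]_d.+1 -> R) (t : R) (v : 'rV[R]_d) :
  let g s := f (cons_rV (s, v)) in
  (derivable f (cons_rV (t, v)) (delta_mx 0 0) -> derivable g t 1) /\
  g^`()%classic t = partial 0 f (cons_rV (t, v)).
Proof.
move=> g; have E : (fun h : R => h^-1 *: ((g \o shift t) (h *: 1) - g t)) =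
    (fun h => h^-1 *: ((f \o shift (cons_rV (t, v))) (h *: delta_mx 0 0) -
       f (cons_rV (t, v)))).
  by apply/funext => h; rewrite /g /= cons_rV_shift0.
by rewrite derive1E /derivable /partial /derive E.
Qed.

Lemma continuous_cons_rV d (t : R) : continuous (fun v : 'rV[R]_d => cons_rV (t, v)).
Proof.
move=> v; have FF : Filter (nbhs v) := nbhs_filter v.
apply/cvg_ballP => e e0; near=> w.
have vw : cube v e w by near: w; exact: cube_nbhs.
rewrite ball_rVE// => i.
case: (unliftP 0 i) => [l|] ->; first by rewrite !cons_rVS; exact: vw.
by rewrite !cons_rV0 /= subrr normr0.
Unshelve. all: by end_near. Qed.

Lemma continuous_cons_rV0 d (v : 'rV[R]_d) : continuous (fun t : R => cons_rV (t, v)).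
Proof.
move=> t; apply/cvg_ballP => e e0; near=> w.
have tw : ball t e w by near: w; exact: (@nbhsx_ballx R R t e).
 rewrite ball_rVE// => i.
case: (unliftP 0 i) => [l|] ->; last by rewrite !cons_rV0 /= distrC.
by rewrite !cons_rVS /= subrr normr0.
Unshelve. all: by end_near. Qed.

Lemma cube0_cons_rV d (t N : R) (v : 'rV[R]_d) :
  cube 0 N (cons_rV (t, v)) -> `|t| < N /\ cube 0 N v.
Proof.
move=> H; split; first by have := H 0; rewrite cons_rV0 mxE subr0.
by move=> j; have := H (lift 0 j); rewrite cons_rVS !mxE.
Qed.

Lemma closed_cube_compact d (a : 'rV[R]_d) (N : R) :
  compact [set x : 'rV[R]_d | forall i, `|x 0 i - a 0 i| <= N].
Proof.
rewrite (_ : mkset _ = [set x : 'rV[R]_d |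
    forall i, `[a 0 i - N, a 0 i + N]%classic (x ord0 i)]).
  apply: (@rV_compact _ _ (fun i => `[a 0 i - N, a 0 i + N]%classic)) => i.
  exact: segment_compact.
apply/seteqP; split => x /= H i; first by rewrite in_itv /= -ler_distl; exact: H.
by have := H i; rewrite in_itv /= -ler_distl.
Qed.

(** By Fubini and induction on the dimension: if the derivative is along the first
    coordinate, integrate first along that coordinate, where the fundamental
    theorem of calculus applies; otherwise integrate first over the remaining
    coordinates, where the induction hypothesis applies to the slices. *)
Lemma integral_partial_eq0 d (f : 'rV[R]_d -> R) k (N : R) :
  (forall x, derivable f x (delta_mx 0 k)) -> continuous (partial k f) ->
  (forall x, ~ cube 0 N x -> f x = 0) ->
  (\int[mu d]_x (partial k f x)%:E = 0)%E.
Proof.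
elim: d f k => [|d IH] f k; first by case: k.
move=> df cf f0.
(* The open cube is replaced by its closure, outside which the derivative
   vanishes as well. *)
have cK := @closed_cube_compact d.+1 0 N.
have f0' (x : 'rV[R]_d.+1) :
    ~ (forall i, `|x 0 i - (0 : 'rV[R]_d.+1) 0 i| <= N) -> f x = 0.
  by move=> H; apply: f0 => cx; apply: H => i; exact/ltW/cx.
have g0 := partial_supp k (compact_closed (@norm_hausdorff _ _) cK) f0'.
have ig := continuous_supp_integrable cf cK g0 measurableT.
have mg : measurable_fun setT (fun x => (partial k f x)%:E).
  exact: (measurable_int _ ig).
pose g (p : measurableTypeR R * 'rV[R]_d) : \bar R := (partial k f (cons_rV p))%:E.
have mcons := @measurable_cons_rV R d.
have iG : (lebesgue_measure \x mu d)%E.-integrable setT g.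
  apply/integrableP; split; first exact: (measurableT_comp mg).
  move/integrableP : ig => [_]; apply: le_lt_trans.
  have -> : (\int[mu d.+1]_x `|(partial k f x)%:E| =
     \int[pushforward (lebesgue_measure \x mu d) (@cons_rV R d)]_x
        `|(partial k f x)%:E|)%E by [].
  by rewrite ge0_integral_pushforward//; exact: measurableT_comp.
have -> : (\int[mu d.+1]_x (partial k f x)%:E =
     \int[pushforward (lebesgue_measure \x mu d) (@cons_rV R d)]_x
        (partial k f x)%:E)%E by [].
rewrite integral_pushforward// preimage_setT.
case: (unliftP 0 k) => [j|] kE.
  rewrite -(integral12_prod_meas1 iG).
  rewrite integral0_eq// => t _; rewrite /fubini_F /g.
  have E v : partial k f (cons_rV (t, v)) = partial j (fun v => f (cons_rV (t, v))) v.
    by rewrite kE; have [_ ->] := derive_cons_rVS f t v j.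
  under eq_integral do rewrite E.
  apply: IH => [v||v Hv].
  - by have [+ _] := derive_cons_rVS f t v j; apply; rewrite -kE.
  - rewrite (_ : partial _ _ = partial k f \o (fun v => cons_rV (t, v))).
      move=> v; apply: continuous_comp; first exact: continuous_cons_rV.
      exact: cf.
    by apply/funext => v /=; rewrite E.
  - by apply: f0 => /cube0_cons_rV[].
rewrite -(integral21_prod_meas1 iG).
rewrite integral0_eq// => v _; rewrite /fubini_G /g.
have E t : partial k f (cons_rV (t, v)) = (fun t => f (cons_rV (t, v)))^`()%classic t.
  by rewrite kE; have [_ ->] := derive_cons_rV0 f t v.
under eq_integral do rewrite E.
apply: (@integral_derive1_eq0 _ N) => [t||t tN].
- by have [+ _] := derive_cons_rV0 f t v; apply; rewrite -kE.
- rewrite (_ : _^`()%classic = partial k f \o (fun t => cons_rV (t, v))).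
    move=> t; apply: continuous_comp; first exact: continuous_cons_rV0.
    exact: cf.
  by apply/funext => t /=; rewrite E.
- by apply: f0 => /cube0_cons_rV[]; rewrite ltNge tN.
Qed.

End integration_by_parts.

(** * Test functions belong to H^1_0 *)

Section test_functions.
Context {R : realType} {d : nat} (Omega : set 'rV[R]_d).
Hypothesis openO : open Omega.
Local Notation mu := (@lebesgue_rV R d).

Let mO : measurable Omega. Proof. exact: open_rV_measurable. Qed.

Lemma smooth_continuous (f : 'rV[R]_d -> R) : smooth f -> continuous f.
Proof. by move=> /(_ [::])[]. Qed.

Lemma smooth_derivable (f : 'rV[R]_d -> R) k x :
  smooth f -> derivable f x (delta_mx 0 k).
Proof. by move=> /(_ [::])[_]; apply. Qed.

Lemma smooth_partial (f : 'rV[R]_d -> R) k : smooth f -> smooth (partial k f).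
Proof. by move=> sf s; have := sf (rcons s k); rewrite foldr_rcons. Qed.

(** The real and imaginary parts of a product of complex functions have this shape,
    and that of [derive_mulDmul]. *)
Lemma derive_mulBmul (f1 f2 g1 g2 : 'rV[R]_d -> R) x v :
  derivable f1 x v -> derivable f2 x v -> derivable g1 x v -> derivable g2 x v ->
  derivable (fun y => f1 y * f2 y - g1 y * g2 y) x v /\
  'D_v (fun y => f1 y * f2 y - g1 y * g2 y) x =
  (f1 x * 'D_v f2 x + f2 x * 'D_v f1 x) - (g1 x * 'D_v g2 x + g2 x * 'D_v g1 x).
Proof.
move=> df1 df2 dg1 dg2.
have df := derivableM df1 df2; have dg := derivableM dg1 dg2.
split; first exact: (derivableB df dg).
exact: (etrans (deriveB df dg)
  (f_equal2 (fun a b => a - b) (deriveM df1 df2) (deriveM dg1 dg2))).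
Qed.

Lemma derive_mulDmul (f1 f2 g1 g2 : 'rV[R]_d -> R) x v :
  derivable f1 x v -> derivable f2 x v -> derivable g1 x v -> derivable g2 x v ->
  derivable (fun y => f1 y * f2 y + g1 y * g2 y) x v /\
  'D_v (fun y => f1 y * f2 y + g1 y * g2 y) x =
  (f1 x * 'D_v f2 x + f2 x * 'D_v f1 x) + (g1 x * 'D_v g2 x + g2 x * 'D_v g1 x).
Proof.
move=> df1 df2 dg1 dg2.
have df := derivableM df1 df2; have dg := derivableM dg1 dg2.
split; first exact: (derivableD df dg).
exact: (etrans (deriveD df dg)
  (f_equal2 (fun a b => a + b) (deriveM df1 df2) (deriveM dg1 dg2))).
Qed.

(** Integration by parts, in the form where the two terms of the product rule are
    already separated. *)
Lemma Rintegral_parts (g h1 h2 : 'rV[R]_d -> R) (K : set 'rV[R]_d) k :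
  compact K -> K `<=` Omega ->
  (forall x, derivable g x (delta_mx 0 k)) -> (forall x, ~ K x -> g x = 0) ->
  continuous h1 -> (forall x, ~ K x -> h1 x = 0) ->
  continuous h2 -> (forall x, ~ K x -> h2 x = 0) ->
  (forall x, partial k g x = h1 x + h2 x) ->
  \int[mu]_(x in Omega) h1 x = - \int[mu]_(x in Omega) h2 x.
Proof.
move=> cK KO dg g0 c1 h10 c2 h20 gE.
apply/eqP; rewrite -subr_eq0 opprK; apply/eqP.
rewrite -RintegralD//; try exact: continuous_supp_integrable c1 cK h10 mO;
  try exact: continuous_supp_integrable c2 cK h20 mO.
rewrite /Rintegral -(@supp_integral _ _ Omega); last first.
  by move=> x Ox; rewrite h10 ?h20 ?addr0// => /KO.
under eq_integral do rewrite -gE.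
have [N N0 KN] := compact_sub_cube cK.
rewrite (@integral_partial_eq0 _ _ _ _ N)//.
  rewrite (_ : partial k g = h1 \+ h2); last exact/funext.
  by move=> x; exact: (cvgD (c1 x) (c2 x)).
by move=> x Nx; apply: g0 => /KN.
Qed.

Lemma continuous_supp_in_L2 (u : 'rV[R]_d -> R[i]) (K : set 'rV[R]_d) :
  continuous (fun x => complex.Re (u x)) ->
  continuous (fun x => complex.Im (u x)) ->
  compact K -> (forall x, ~ K x -> u x = 0) -> in_L2 Omega u.
Proof.
move=> cr ci cK u0; split; first by split; exact: continuous_rV_measurable.
have /integrableP[_] : mu.-integrable Omega (fun x => (sqnorm (u x))%:E).
  apply: (@continuous_supp_integrable _ _ (fun x => sqnorm (u x)) K) => //.
    rewrite (_ : (fun x => _) =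
      (fun x => complex.Re (u x)) \* (fun x => complex.Re (u x)) \+
      (fun x => complex.Im (u x)) \* (fun x => complex.Im (u x))).
      by move=> x; exact: (cvgD (cvgM (cr x) (cr x)) (cvgM (ci x) (ci x))).
    by apply/funext => x; rewrite sqnormE !expr2.
  by move=> x /u0 ->; rewrite sqnormE /= expr0n addr0.
by under eq_integral do rewrite /= ger0_norm ?sqnorm_ge0//.
Qed.

Lemma cpartial_supp (u : 'rV[R]_d -> R[i]) (K : set 'rV[R]_d) k :
  closed K -> (forall x, ~ K x -> u x = 0) ->
  forall x, ~ K x -> cpartial k u x = 0.
Proof.
by move=> cK u0 x Kx; rewrite /cpartial !(partial_supp _ cK)// => y /u0 ->.
Qed.

Lemma test_weak_partial (u : 'rV[R]_d -> R[i]) k :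
  test_function Omega u -> weak_partial Omega k u (cpartial k u).
Proof.
move=> [sr si [K [cK KO u0]]] v [sr' si' [K' [cK' KO' v0]]].
have clK : closed K := compact_closed (@norm_hausdorff _ _) cK.
set ur := (fun x => complex.Re (u x)) in sr.
set ui := (fun x => complex.Im (u x)) in si.
set vr := (fun x => complex.Re (v x)) in sr'.
set vi := (fun x => complex.Im (v x)) in si'.
have ur0 x : ~ K x -> ur x = 0 by move=> /u0; rewrite /ur => ->.
have ui0 x : ~ K x -> ui x = 0 by move=> /u0; rewrite /ui => ->.
have dur0 := partial_supp k clK ur0.
have dui0 := partial_supp k clK ui0.
have [cur cui cvr cvi] : [/\ continuous ur, continuous ui, continuous vr & continuous vi].
  by split; exact: smooth_continuous.
have [dur dui dvr dvi] : [/\ forall x, derivable ur x (delta_mx 0 k),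
   forall x, derivable ui x (delta_mx 0 k), forall x, derivable vr x (delta_mx 0 k) &
   forall x, derivable vi x (delta_mx 0 k)].
  by split=> x; exact: smooth_derivable.
have [cdur cdui cdvr cdvi] : [/\ continuous (partial k ur),
  continuous (partial k ui), continuous (partial k vr) & continuous (partial k vi)].
  by split; apply: smooth_continuous; exact: smooth_partial.
rewrite /cintegral /cpartial -/ur -/ui -/vr -/vi.
have reE x : u x = Complex (ur x) (ui x) by rewrite /ur /ui; case: (u x).
have reE' x : v x = Complex (vr x) (vi x) by rewrite /vr /vi; case: (v x).
have cB (f1 f2 g1 g2 : 'rV[R]_d -> R) : continuous f1 -> continuous f2 ->
    continuous g1 -> continuous g2 -> continuous (fun x => f1 x * f2 x - g1 x * g2 x).
  by move=> h1 h2 h3 h4 x; exact: (cvgB (cvgM (h1 x) (h2 x)) (cvgM (h3 x) (h4 x))).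
have cD (f1 f2 g1 g2 : 'rV[R]_d -> R) : continuous f1 -> continuous f2 ->
    continuous g1 -> continuous g2 -> continuous (fun x => f1 x * f2 x + g1 x * g2 x).
  by move=> h1 h2 h3 h4 x; exact: (cvgD (cvgM (h1 x) (h2 x)) (cvgM (h3 x) (h4 x))).
apply/eqP; rewrite eq_complex /=; apply/andP; split; apply/eqP.
- apply: (Rintegral_parts (g := fun x => ur x * vr x - ui x * vi x) (k := k) cK KO).
  + by move=> x; have [] := derive_mulBmul (dur x) (dvr x) (dui x) (dvi x).
  + by move=> x Kx; rewrite ur0// ui0// !mul0r subr0.
  + under eq_fun do rewrite reE /=; exact: cB.
  + by move=> x Kx; rewrite u0// mul0r.
  + under eq_fun do rewrite reE' /=; exact: cB.
  + by move=> x Kx; rewrite dur0// dui0// mul0r.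
  + move=> x; rewrite reE reE' /= /partial.
    by have [_ ->] := derive_mulBmul (dur x) (dvr x) (dui x) (dvi x); ring.
- apply: (Rintegral_parts (g := fun x => ur x * vi x + ui x * vr x) (k := k) cK KO).
  + by move=> x; have [] := derive_mulDmul (dur x) (dvi x) (dui x) (dvr x).
  + by move=> x Kx; rewrite ur0// ui0// !mul0r addr0.
  + under eq_fun do rewrite reE /=; exact: cD.
  + by move=> x Kx; rewrite u0// mul0r.
  + under eq_fun do rewrite reE' /=; exact: cD.
  + by move=> x Kx; rewrite dur0// dui0// mul0r.
  + move=> x; rewrite reE reE' /= /partial.
    by have [_ ->] := derive_mulDmul (dur x) (dvi x) (dui x) (dvr x); ring.
Qed.

Definition test_pair (u : 'rV[R]_d -> R[i]) : with_grad :=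
  (u, fun k => cpartial k u).

Lemma test_in_H10 u : test_function Omega u -> in_H10 Omega (test_pair u).
Proof.
move=> tu; have [sr si [K [cK KO u0]]] := tu.
have clK : closed K := compact_closed (@norm_hausdorff _ _) cK.
split; first split.
- by apply: (continuous_supp_in_L2 (smooth_continuous sr) (smooth_continuous si) cK).
- move=> k; split; last exact: test_weak_partial.
  apply: (continuous_supp_in_L2 _ _ cK); last exact: cpartial_supp.
    exact: smooth_continuous (smooth_partial k sr).
  exact: smooth_continuous (smooth_partial k si).
move=> e e0; exists u => //; rewrite subrr /H1_sqnorm /L2_sqnorm.
rewrite integral0_eq; last by move=> x _; rewrite sqnormE /= expr0n addr0.
by rewrite big1 ?adde0 ?lte_fin.
Qed.

End test_functions.

(** * Bump functions *)

Section bump_functions.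
Context {R : realType}.

(** The derivatives of exp(-1/t), extended by 0 for t <= 0, are combinations of
    the functions t^-n exp(-1/t); taking all of them at once makes the family
    closed under differentiation. *)
Definition flat n (t : R) : R := if 0 < t then t^-1 ^+ n * expR (- t^-1) else 0.

Lemma flat_le0 n t : t <= 0 -> flat n t = 0.
Proof. by rewrite /flat ltNge => ->. Qed.

Lemma flat_gt0 n t : 0 < t -> 0 < flat n t.
Proof. by move=> t0; rewrite /flat t0 mulr_gt0 ?expR_gt0// exprn_gt0// invr_gt0. Qed.

Lemma flat_ge0 n t : 0 <= flat n t.
Proof. by have [/flat_le0 ->//|/(flat_gt0 n)/ltW] := leP t 0. Qed.

(** The exponential dominates s^(n+2) at s = 1/t; the quadratic bound yields a zero
    derivative at the origin. *)
Lemma flat_le_sqr n t : `|flat n t| <= n.+2`!%:R * t ^+ 2.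
Proof.
have [t0|t0] := leP t 0; first by rewrite flat_le0// normr0 mulr_ge0// sqr_ge0.
rewrite ger0_norm ?flat_ge0// /flat t0 expRN.
have s0 : 0 <= t^-1 by rewrite invr_ge0 ltW.
have e0 := expR_gt0 t^-1.
rewrite ler_pdivrMr//.
have := expR_ge1Dxn n.+1 s0; set f := n.+2`!%:R => H.
have f0 : 0 < f by rewrite ltr0n fact_gt0.
have {}H : t^-1 ^+ n.+2 <= f * expR t^-1.
  by rewrite mulrC -ler_pdivrMr//; move: H; set A := _ / f; lra.
have -> : t^-1 ^+ n = t^-1 ^+ n.+2 * t ^+ 2.
  by rewrite -addn2 exprD -mulrA -exprMn mulVf ?gt_eqF// expr1n mulr1.
by rewrite [leRHS]mulrAC ler_wpM2r// sqr_ge0.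
Qed.

Lemma is_derive_flat n (t : R) :
  is_derive t 1 (flat n) (flat n.+2 t - n%:R * flat n.+1 t).
Proof.
have [t0|t0|->] := ltgtP t 0.
- rewrite !flat_le0 ?ltW// mulr0 subr0.
  apply: (@near_eq_is_derive _ _ _ (cst 0)).
  have : nbhs t [set x | x < 0] by apply: open_nbhs_nbhs; split => //; exact: open_lt.
  by apply: filterS => x /= /ltW /(flat_le0 n) ->.
- pose g x : R := x^-1 ^+ n * expR (- x^-1).
  apply: (@near_eq_is_derive _ _ _ g).
    have : nbhs t [set x | 0 < x] by apply: open_nbhs_nbhs; split => //; exact: open_gt.
    by apply: filterS => x /= x0; rewrite /flat x0.
  have dV : is_derive t 1 (fun x : R => x^-1) (- t ^- 2 *: 1).
    by apply: (@is_deriveV _ id) => //; rewrite gt_eqF.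
  have dE : is_derive t 1 (expR \o (fun x : R => - x^-1)) (expR (- t^-1) * - (- t ^- 2 *: 1)).
    by apply: is_derive1_comp; exact: is_deriveN.
  have dX := @is_deriveX _ _ _ n t 1 _ dV.
  have invX x : ((fun y : R => y^-1) ^+ n) x = x^-1 ^+ n by rewrite exprfctE.
  have -> : g = (fun x : R => x^-1) ^+ n * (expR \o (fun x : R => - x^-1)).
    by apply/funext => x; rewrite /g -invX.
  apply: is_derive_eq (is_deriveM dX dE) _.
  rewrite invX /flat t0 /= /GRing.scale /= !mulr1.
  case: n {g dX invX} => [|n]; rewrite ?mul0r ?mulr0 ?subr0 ?addr0 /= ?exprS ?expr0.
    by field; rewrite gt_eqF.
  by field; rewrite gt_eqF.
- rewrite !flat_le0// mulr0 subr0.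
  pose q := fun h : R => h^-1 *: ((flat n \o shift 0) (h *: (1 : R)) - flat n 0).
  have q0 : q h @[h --> 0^'] --> (0 : R).
    apply/cvgrPdist_le => e e0; near=> h.
    rewrite sub0r normrN /q /= (flat_le0 n (lexx 0)) subr0 addr0 /GRing.scale /= mulr1.
    have h0 : h != 0 by near: h; exact: nbhs_dnbhs_neq.
    rewrite normrM normfV mulrC ler_pdivrMr ?normr_gt0//.
    apply: le_trans (flat_le_sqr n h) _.
    rewrite -real_normK ?num_real// expr2 mulrA ler_wpM2r//.
    rewrite -ler_pdivlMl ?ltr0n ?fact_gt0//.
    near: h; apply: dnbhs0_le; rewrite mulr_gt0// invr_gt0 ltr0n fact_gt0//.
  apply: DeriveDef; first by rewrite /derivable; apply/cvg_ex; exists 0.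
  by rewrite /derive; exact/cvg_lim.
Unshelve. all: by end_near. Qed.

Lemma continuous_flat n : continuous (flat n).
Proof.
move=> t; apply: differentiable_continuous; apply/derivable1_diffP.
exact: (@ex_derive _ _ _ _ _ _ _ (is_derive_flat n t)).
Qed.

Lemma is_derive_coord d (F : R -> R) (x : 'rV[R]_d) (j k : 'I_d) a :
  is_derive (x 0 k) 1 F a ->
  is_derive x (delta_mx 0 j) (fun y => F (y 0 k)) (if j == k then a else 0).
Proof.
move=> dF; pose G := if j == k then F else cst (F (x 0 k)).
have dG : is_derive (x 0 k) 1 G (if j == k then a else 0).
  by rewrite /G; case: ifP => _; [exact: dF|exact: is_derive_cst].
(* Along a line of direction j the k-th coordinate either moves at unit speed
   or stays constant. *)
have E : (fun h : R => h^-1 *: (((fun y : 'rV[R]_d => F (y 0 k)) \o shift x)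
      (h *: delta_mx 0 j) - F (x 0 k))) =
    (fun h => h^-1 *: ((G \o shift (x 0 k)) (h *: 1) - G (x 0 k))).
  apply/funext => h; rewrite /G /= !mxE eqxx andTb [k == j]eq_sym.
  by case: (j == k) => //=; rewrite /GRing.scale /= mulr0 add0r.
move: dG => [dG dGE]; apply: DeriveDef; first by rewrite /derivable E.
by rewrite /derive E.
Qed.

(** The functions of R^d generated by the flat functions of affine functions of one
    coordinate.  Their smoothness is immediate once this class is known to be
    closed under partial derivatives, which avoids any Leibniz formula for
    iterated derivatives. *)
Inductive flat_alg d : ('rV[R]_d -> R) -> Prop :=
| flat_alg_cst c : flat_alg (cst c)
| flat_alg_coord n k a s : flat_alg (fun x => flat n (a + s * x 0 k))
| flat_algD f g : flat_alg f -> flat_alg g -> flat_alg (fun x => f x + g x)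
| flat_algM f g : flat_alg f -> flat_alg g -> flat_alg (fun x => f x * g x).

Lemma flat_alg_continuous d (f : 'rV[R]_d -> R) : flat_alg f -> continuous f.
Proof.
elim=> {f} [c|n k a s|f g _ cf _ cg|f g _ cf _ cg] x.
- exact: cst_continuous.
- apply: (@continuous_comp _ _ _ (fun x : 'rV[R]_d => a + s * x 0 k));
    last exact: continuous_flat.
  have cx : {for x, continuous (fun y : 'rV[R]_d => y 0 k)} by exact: coord_continuous.
  have cc b : {for x, continuous (fun=> b : R)} by exact: cst_continuous.
  exact: (cvgD (cc a) (cvgM (cc s) cx)).
- exact: (cvgD (cf x) (cg x)).
- exact: (cvgM (cf x) (cg x)).
Qed.

Lemma flat_alg_partial d (f : 'rV[R]_d -> R) k : flat_alg f ->
  (forall x, derivable f x (delta_mx 0 k)) /\ flat_alg (partial k f).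
Proof.
have H n (a s t : R) : is_derive t 1 (fun t : R => flat n (a + s * t))
    ((flat n.+2 (a + s * t) - n%:R * flat n.+1 (a + s * t)) * s).
  apply: (@is_derive1_comp _ (flat n) (fun t : R => a + s * t)).
    exact: is_derive_flat.
  have dZ := is_deriveD (is_derive_cst a t 1) (is_deriveZ s (is_derive_id t (1 : R))).
  by apply: is_derive_eq dZ _; rewrite add0r /GRing.scale /= mulr1.
elim=> {f} [c|n j a s|f g _ [df Pf] _ [dg Pg]|f g Af [df Pf] Ag [dg Pg]].
- split=> [x|]; first exact: derivable_cst.
  rewrite (_ : partial k _ = cst 0); first exact: flat_alg_cst.
  by apply/funext => x; rewrite /partial derive_cst.
- have dE (x : 'rV[R]_d) := is_derive_coord k (H n a s (x 0 j)).
  split=> [x|]; first exact: (@ex_derive _ _ _ _ _ _ _ (dE x)).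
  rewrite (_ : partial k _ = fun x => if k == j then
    (flat n.+2 (a + s * x 0 j) + (- n%:R) * flat n.+1 (a + s * x 0 j)) * s else 0).
    case: (k == j); last exact: flat_alg_cst.
    apply: flat_algM; last exact: flat_alg_cst.
    apply: flat_algD; first exact: flat_alg_coord.
    by apply: flat_algM; [exact: flat_alg_cst|exact: flat_alg_coord].
  apply/funext => x; rewrite /partial (@derive_val _ _ _ _ _ _ _ (dE x)).
  by rewrite mulNr.
- split=> [x|]; first exact: (derivableD (df x) (dg x)).
  rewrite (_ : partial k _ = fun x => partial k f x + partial k g x).
    exact: flat_algD.
  by apply/funext => x; exact: (deriveD (df x) (dg x)).
- split=> [x|]; first exact: (derivableM (df x) (dg x)).
  rewrite (_ : partial k _ = fun x => f x * partial k g x + g x * partial k f x).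
    by apply: flat_algD; exact: flat_algM.
  by apply/funext => x; exact: (deriveM (df x) (dg x)).
Qed.

Lemma flat_alg_smooth d (f : 'rV[R]_d -> R) : flat_alg f -> smooth f.
Proof.
move=> Af s; have {Af} As : flat_alg (foldr partial f s).
  by elim: s => [//|k s /(@flat_alg_partial _ _ k)[]].
by split=> [|k x]; [exact: flat_alg_continuous|have [] := flat_alg_partial k As].
Qed.

(** The product over the coordinates of flat functions of the distances to the two
    opposite faces of the cube. *)
Lemma bump_exists d (a : 'rV[R]_d) r : exists f : 'rV[R]_d -> R,
  [/\ smooth f, forall x, cube a r x -> 0 < f x &
    forall x, ~ cube a r x -> f x = 0].
Proof.
exists (fun x => \prod_(k < d)
  (flat 0 (r - a 0 k + 1 * x 0 k) * flat 0 (r + a 0 k + -1 * x 0 k))).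
split.
- apply: flat_alg_smooth.
  elim: (index_enum _) => [|k s IH].
    by under eq_fun do rewrite big_nil; exact: flat_alg_cst.
  under eq_fun do rewrite big_cons.
  by apply: flat_algM => //; apply: flat_algM; exact: flat_alg_coord.
- move=> x ax; rewrite prodr_gt0// => k _.
  have := ax k; rewrite ltr_norml => /andP[? ?].
  by rewrite mulr_gt0// flat_gt0//; lra.
- move=> x /existsNP[k /negP]; rewrite -leNgt => xk.
  rewrite (bigD1 k)//=.
  have [xa|xa] := leP 0 (x 0 k - a 0 k).
    rewrite [X in _ * X * _]flat_le0 ?mulr0 ?mul0r//.
    by move: xk; rewrite ger0_norm//; lra.
  rewrite [X in X * _ * _]flat_le0 ?mul0r//.
  by move: xk; rewrite ltr0_norm//; lra.
Qed.

End bump_functions.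

(** * Uniform coercivity implies coercivity of the form *)

(** The integrand of the form is not known to be measurable when C is merely
    bounded, but monotonicity of the integral of nonnegative functions holds
    without measurability, since it is a supremum over simple functions below. *)
Lemma ge0_le_integral_nonmeasurable d (T : measurableType d) (R : realType)
    (mu : {measure set T -> \bar R}) (D : set T) (f g : T -> \bar R) :
  (forall x, D x -> 0 <= f x)%E -> (forall x, D x -> f x <= g x)%E ->
  (\int[mu]_(x in D) f x <= \int[mu]_(x in D) g x)%E.
Proof.
move=> f0 fg; rewrite [leLHS]integral_mkcond [leRHS]integral_mkcond.
have h0 x : (0 <= (f \_ D) x)%E by exact: erestrict_ge0.
have hg x : ((f \_ D) x <= (g \_ D) x)%E by exact: lee_restrict.
rewrite !ge0_integralTE//; last by move=> x; exact: le_trans (h0 x) (hg x).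
apply: ereal_sup_le => _ [h hf <-]; exists h => // x.
exact: le_trans (hf x) (hg x).
Qed.

Section gradient_norm.
Context {R : realType} {d : nat} (Omega : set 'rV[R]_d).

Lemma measurable_sqnorm (u : 'rV[R]_d -> R[i]) :
  measurable_cfun Omega u -> measurable_fun Omega (fun x => (sqnorm (u x))%:E).
Proof.
move=> [mr mi]; apply/measurable_EFinP.
under eq_fun do rewrite sqnormE.
by apply: measurable_funD; apply: measurable_funX.
Qed.

Lemma L2_sqnorm_ge0 (u : 'rV[R]_d -> R[i]) : (0 <= L2_sqnorm Omega u)%E.
Proof. by apply: integral_ge0 => x _; rewrite lee_fin sqnorm_ge0. Qed.

Lemma H1_sqnorm_ge0 (u : with_grad) : (0 <= H1_sqnorm Omega u)%E.
Proof.
by rewrite adde_ge0 ?sume_ge0 ?L2_sqnorm_ge0// => k _; exact: L2_sqnorm_ge0.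
Qed.

Lemma Re_grad_dot (u : with_grad) : in_H1 Omega u ->
  ((complex.Re (grad_dot Omega u u))%:E = \sum_(k < d) L2_sqnorm Omega (u.2 k))%E.
Proof.
move=> [_ uH]; rewrite /grad_dot raddf_sum -sumEFin; apply: eq_bigr => k _ /=.
have [[_ Loo] _] := uH k.
rewrite /Rintegral.
under eq_integral do rewrite Re_mul_conj -!expr2 -sqnormE.
by rewrite fineK// ge0_fin_numE// L2_sqnorm_ge0.
Qed.

End gradient_norm.

Section sufficiency.
Context {R : realType} {d : nat} (Omega : set 'rV[R]_d).
Variable C : 'rV[R]_d -> {linear ell2 R -> ell2 R}.
Hypothesis openO : open Omega.
Local Notation mu := (@lebesgue_rV R d).
Local Open Scope ereal_scope.

Let mO : measurable Omega. Proof. exact: open_rV_measurable. Qed.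

(** At the exceptional points the series is infinite, its finite part is 0, and so is
    the vector that replaces the sequence. *)
Lemma sqr_norm_V_partial k (psi : nat -> @with_grad R d) x :
  (ell2_norm (V_partial k psi x) ^+ 2)%R =
  fine (\sum_(0 <= i <oo) (sqnorm ((psi i).2 k x))%:E).
Proof.
rewrite /V_partial /insubd; case: insubP => [y yl yE|Nl].
  have -> : \sum_(0 <= i <oo) (sqnorm ((psi i).2 k x))%:E =
      \sum_(0 <= i <oo) (sqnorm (y i))%:E.
    by apply: eq_eseriesr => i _; rewrite -[ell2_val y]/(val y) yE.
  by rewrite -sqr_ell2_norm.
have -> : \sum_(0 <= i <oo) (sqnorm ((psi i).2 k x))%:E = +oo.
  by move: Nl => /asboolPn; rewrite ltey => /negP; rewrite negbK => /eqP.
rewrite /=; apply: EFin_inj; rewrite sqr_ell2_norm eseries0// => i _ _.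
by rewrite sqnormE /= expr0n /= addr0.
Qed.

Lemma measurable_sqr_norm_V_partial k (psi : nat -> with_grad) :
  (forall i, in_H10 Omega (psi i)) ->
  measurable_fun Omega (fun x => (ell2_norm (V_partial k psi x) ^+ 2)%:E).
Proof.
move=> psiH; under eq_fun do rewrite sqr_norm_V_partial.
apply/measurable_EFinP; apply: (measurableT_comp (fine_measurable measurableT)).
apply: ge0_emeasurable_sum => [i x _ _|i _]; first by rewrite lee_fin sqnorm_ge0.
by have [[_ /(_ k)[[m _] _]] _] := psiH i; exact: measurable_sqnorm.
Qed.

(** Monotone convergence exchanges the sum over the components and the integral;
    finiteness of the sum then makes the exceptional points negligible. *)
Lemma integral_sqr_norm_V_partial (psi : nat -> @with_grad R d) :
  in_V Omega psi ->
  \int[mu]_(x in Omega) (\sum_(k < d) ell2_norm (V_partial k psi x) ^+ 2)%:E =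
  \sum_(0 <= i <oo) \sum_(k < d) L2_sqnorm Omega ((psi i).2 k) /\
  \sum_(0 <= i <oo) \sum_(k < d) L2_sqnorm Omega ((psi i).2 k) < +oo.
Proof.
move=> [psiH psioo].
pose S k x := \sum_(0 <= i <oo) (sqnorm ((psi i).2 k x))%:E.
have S0 k x : 0 <= S k x by apply: nneseries_ge0 => i _ _; rewrite lee_fin sqnorm_ge0.
have mi i k : measurable_fun Omega (fun x => (sqnorm ((psi i).2 k x))%:E).
  by have [[_ /(_ k)[[m _] _]] _] := psiH i; exact: measurable_sqnorm.
have mS k : measurable_fun Omega (S k).
  by apply: ge0_emeasurable_sum => // i x _ _; rewrite lee_fin sqnorm_ge0.
have intS k : \int[mu]_(x in Omega) S k x = \sum_(0 <= i <oo) L2_sqnorm Omega ((psi i).2 k).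
  by rewrite integral_nneseries// => i x _; rewrite lee_fin sqnorm_ge0.
have sumE : \sum_(0 <= i <oo) \sum_(k < d) L2_sqnorm Omega ((psi i).2 k) =
    \sum_(k < d) \sum_(0 <= i <oo) L2_sqnorm Omega ((psi i).2 k).
  rewrite (@nneseries_sum _ _ xpredT _ (fun k i => L2_sqnorm Omega ((psi i).2 k)))// => k i _.
  exact: L2_sqnorm_ge0.
have sumoo : \sum_(0 <= i <oo) \sum_(k < d) L2_sqnorm Omega ((psi i).2 k) < +oo.
  apply: le_lt_trans psioo; apply: lee_nneseries => i _.
    by move=> _; apply: sume_ge0 => k _; exact: L2_sqnorm_ge0.
  by rewrite leeDr// L2_sqnorm_ge0.
split => //; rewrite sumE.
have S_oo k : \int[mu]_(x in Omega) S k x < +oo.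
  rewrite intS; apply: le_lt_trans sumoo; rewrite sumE (bigD1 k)//= leeDl//.
  apply: sume_ge0 => j _; apply: nneseries_ge0 => i _ _; exact: L2_sqnorm_ge0.
under eq_integral do rewrite -sumEFin.
have mN k := measurable_sqr_norm_V_partial k psiH.
rewrite ge0_integral_sum//; last by move=> k x _; rewrite lee_fin sqr_ge0.
apply: eq_bigr => k _; rewrite -intS.
apply: ae_eq_integral => //.
have /integrable_ae : mu.-integrable Omega (S k).
  apply/integrableP; split => //.
  by under eq_integral do rewrite gee0_abs//.
move=> /(_ mO); apply: filterS => x Sf Ox.
by rewrite sqr_norm_V_partial fineK//; exact: Sf.
Qed.

Lemma coercive_form_of_uniformly_coercive :
  poincare_type Omega -> uniformly_bounded Omega C ->
  uniformly_coercive Omega C -> coercive_form Omega (V_form Omega C).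
Proof.
move=> [_ [c1 [c2 [c10 _ poi]]]] [M CM] [a a0 Ca].
exists (a * c1)%R => [|psi psiV]; first exact: mulr_gt0.
have [intE intoo] := integral_sqr_norm_V_partial psiV.
have [psiH _] := psiV.
pose N x := (\sum_(k < d) ell2_norm (V_partial k psi x) ^+ 2)%R.
pose F x := complex.Re (\sum_(k < d)
    ell2_dot (C x (V_partial k psi x)) (V_partial k psi x))%R.
have N0 x : (0 <= N x)%R by apply: sumr_ge0 => k _; exact: sqr_ge0.
have N0' x : Omega x -> 0 <= (N x)%:E by rewrite lee_fin.
have mN : measurable_fun Omega (fun x => (N x)%:E).
  rewrite /N; under eq_fun do rewrite -sumEFin.
  by apply: emeasurable_sum => k; exact: measurable_sqr_norm_V_partial.
have aNF x : Omega x -> (a * N x <= F x)%R.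
  move=> Ox; rewrite /F raddf_sum /N mulr_sumr; apply: ler_sum => k _; exact: Ca.
(* Any positive bound of the operators will do; M itself may vanish. *)
pose M' := (`|M| + 1)%R.
have M'0 : (0 < M')%R by rewrite ltr_wpDl.
have FMN x : Omega x -> (F x <= M' * N x)%R.
  move=> Ox; rewrite /F raddf_sum /N mulr_sumr; apply: ler_sum => k _.
  apply: Re_ell2_dot_le => //; apply: opnorm_bound.
    by move=> b z; exact: linearZ.
  apply: le_trans (CM x Ox) _; rewrite lee_fin /M'.
  by rewrite (le_trans (ler_norm _))// lerDl.
have intF : \int[mu]_(x in Omega) (F x)%:E < +oo.
  apply: (@le_lt_trans _ _ (\int[mu]_(x in Omega) (M'%:E * (N x)%:E))).
    apply: ge0_le_integral_nonmeasurable => x Ox; rewrite lee_fin ?FMN//.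
    by apply: le_trans (aNF x Ox); rewrite mulr_ge0// ltW.
  rewrite ge0_integralZl_EFin//; last exact: ltW.
  by rewrite intE lte_mul_pinfty// lee_fin ltW.
have intF0 : 0 <= \int[mu]_(x in Omega) (F x)%:E.
  apply: integral_ge0 => x Ox; rewrite lee_fin.
  by apply: le_trans (aNF x Ox); rewrite mulr_ge0// ltW.
change ((a * c1)%:E * V_sqnorm Omega psi <=
  (fine (\int[mu]_(x in Omega) (F x)%:E))%:E).
rewrite fineK ?ge0_fin_numE//.
apply: (@le_trans _ _ (\int[mu]_(x in Omega) (a%:E * (N x)%:E))); last first.
  apply: ge0_le_integral_nonmeasurable => x Ox; rewrite -EFinM lee_fin ?aNF//.
  by rewrite mulr_ge0// ltW.
rewrite ge0_integralZl_EFin//; last exact: ltW.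
rewrite intE EFinM -muleA lee_pmul2l//.
rewrite -nneseriesZl//; last by move=> i _; exact: H1_sqnorm_ge0.
apply: lee_nneseries => i _.
  by move=> _; rewrite mule_ge0 ?H1_sqnorm_ge0// lee_fin ltW.
rewrite -Re_grad_dot; last by have [] := psiH i.
by have /andP[] := poi _ (psiH i).
Qed.

End sufficiency.

(** * Coercivity of the form implies uniform coercivity *)

Section necessity.
Context {R : realType} {d : nat} (Omega : set 'rV[R]_d).
Variable C : 'rV[R]_d -> {linear ell2 R -> ell2 R}.
Hypothesis openO : open Omega.
Local Notation mu := (@lebesgue_rV R d).
Local Open Scope complex_scope.
Implicit Types f : 'rV[R]_d -> R.

Let mO : measurable Omega. Proof. exact: open_rV_measurable. Qed.

(** The elementary tensor of y and f in the direct sum V. *)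
Definition tensor (y : ell2 R) (f : 'rV[R]_d -> R) (i : nat) : with_grad :=
  test_pair (fun x => y i * (f x)%:C).

Definition sqr_grad (f : 'rV[R]_d -> R) x : R := \sum_(k < d) partial k f x ^+ 2.

Lemma smoothZ (c : R) (f : 'rV[R]_d -> R) :
  smooth f -> smooth (fun x => c * f x).
Proof.
move=> sf s.
have -> : foldr partial (fun x => c * f x) s = (fun x => c * foldr partial f s x).
  elim: s => [//|k s IH] /=; rewrite IH; apply/funext => x.
  exact: (deriveZ c ((sf s).2 k x)).
split=> [x|k x]; last exact: (derivableZ (k:=c) ((sf s).2 k x)).
have cc : {for x, continuous (fun=> c)} by exact: cst_continuous.
exact: (cvgM cc ((sf s).1 x)).
Qed.

Lemma test_functionZ (z : R[i]) (f : 'rV[R]_d -> R) (K : set 'rV[R]_d) :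
  smooth f -> compact K -> K `<=` Omega -> (forall x, ~ K x -> f x = 0) ->
  test_function Omega (fun x => z * (f x)%:C).
Proof.
move=> sf cK KO f0; split.
- rewrite (_ : (fun x => _) = (fun x => complex.Re z * f x)); first exact: smoothZ.
  by apply/funext => x; case: z => p q /=; ring.
- rewrite (_ : (fun x => _) = (fun x => complex.Im z * f x)); first exact: smoothZ.
  by apply/funext => x; case: z => p q /=; ring.
- by exists K; split => // x /f0 ->; rewrite mulr0.
Qed.

Lemma cpartialZ (z : R[i]) (f : 'rV[R]_d -> R) k : smooth f ->
  cpartial k (fun x => z * (f x)%:C) = (fun x => z * (partial k f x)%:C).
Proof.
move=> sf; apply/funext => x; rewrite /cpartial.
have -> : (fun y => complex.Re (z * (f y)%:C)) = (fun y => complex.Re z * f y).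
  by apply/funext => y; case: z => p q /=; ring.
have -> : (fun y => complex.Im (z * (f y)%:C)) = (fun y => complex.Im z * f y).
  by apply/funext => y; case: z => p q /=; ring.
have H c : partial k (fun y => c * f y) x = c * partial k f x.
  exact: (deriveZ c (smooth_derivable (k := k) (x := x) sf)).
rewrite !H; case: z => p q /=.
by apply/eqP; rewrite eq_complex /=; apply/andP; split; apply/eqP; ring.
Qed.

Lemma sqnormM_real (z : R[i]) (t : R) : sqnorm (z * t%:C) = sqnorm z * t ^+ 2.
Proof. by rewrite !sqnormE; case: z => p q /=; ring. Qed.

Lemma L2_sqnormZ (z : R[i]) (f : 'rV[R]_d -> R) : measurable_fun Omega f ->
  L2_sqnorm Omega (fun x => z * (f x)%:C) =
  ((sqnorm z)%:E * \int[mu]_(x in Omega) (f x ^+ 2)%:E)%E.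
Proof.
move=> mf; rewrite /L2_sqnorm; under eq_integral do rewrite sqnormM_real EFinM.
rewrite ge0_integralZl_EFin// ?sqnorm_ge0//.
- by move=> x _; rewrite lee_fin sqr_ge0.
- by apply/measurable_EFinP; exact: measurable_funX.
Qed.

Lemma smooth_measurable (f : 'rV[R]_d -> R) : smooth f -> measurable_fun Omega f.
Proof. by move=> /smooth_continuous cf; exact: continuous_rV_measurable. Qed.

Lemma sqr_grad_ge0 f x : 0 <= sqr_grad f x.
Proof. by apply: sumr_ge0 => k _; exact: sqr_ge0. Qed.

Lemma measurable_sqr_grad f : smooth f ->
  measurable_fun Omega (fun x => (sqr_grad f x)%:E).
Proof.
move=> sf; apply/measurable_EFinP; apply: measurable_sum => k.
by apply: measurable_funX; apply: smooth_measurable; exact: smooth_partial.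
Qed.

Lemma sum_L2_sqnorm_partial (z : R[i]) f : smooth f ->
  (\sum_(k < d) L2_sqnorm Omega (cpartial k (fun x => z * (f x)%:C)%R) =
  (sqnorm z)%:E * \int[mu]_(x in Omega) (sqr_grad f x)%:E)%E.
Proof.
move=> sf; under [in RHS]eq_integral do rewrite -sumEFin.
rewrite ge0_integral_sum//; last 2 first.
- move=> k; apply/measurable_EFinP; apply: measurable_funX.
  by apply: smooth_measurable; exact: smooth_partial.
- by move=> k x _; rewrite lee_fin sqr_ge0.
rewrite ge0_sume_distrr; last first.
  by move=> k _; apply: integral_ge0 => x _; rewrite lee_fin sqr_ge0.
apply: eq_bigr => k _; rewrite cpartialZ// L2_sqnormZ//.
by apply: smooth_measurable; exact: smooth_partial.
Qed.

Lemma H1_sqnorm_test (z : R[i]) f : smooth f ->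
  (H1_sqnorm Omega (test_pair (fun x => z * (f x)%:C)%R) =
  (sqnorm z)%:E * (\int[mu]_(x in Omega) (f x ^+ 2)%:E +
    \int[mu]_(x in Omega) (sqr_grad f x)%:E))%E.
Proof.
move=> sf; rewrite /H1_sqnorm /= sum_L2_sqnorm_partial// L2_sqnormZ//; last first.
  exact: smooth_measurable.
rewrite [RHS]ge0_muleDr//.
- by apply: integral_ge0 => x _; rewrite lee_fin sqr_ge0.
- by apply: integral_ge0 => x _; rewrite lee_fin sqr_grad_ge0.
Qed.

Lemma in_H1_lty (u : with_grad) : in_H1 Omega u -> (H1_sqnorm Omega u < +oo)%E.
Proof.
move=> [[_ u0] uk]; apply: lte_add_pinfty => //; apply: lte_sum_pinfty => k _.
by have [[]] := uk k.
Qed.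

Lemma test_H1_lty f (K : set 'rV[R]_d) :
  smooth f -> compact K -> K `<=` Omega -> (forall x, ~ K x -> f x = 0) ->
  (\int[mu]_(x in Omega) (f x ^+ 2)%:E +
    \int[mu]_(x in Omega) (sqr_grad f x)%:E < +oo)%E.
Proof.
move=> sf cK KO f0; have tf := test_functionZ 1 sf cK KO f0.
have [/in_H1_lty + _] := test_in_H10 openO tf.
by rewrite H1_sqnorm_test// sqnormE /= expr1n expr0n addr0 mul1e.
Qed.

Lemma V_sqnorm_tensor y f (K : set 'rV[R]_d) :
  smooth f -> compact K -> K `<=` Omega -> (forall x, ~ K x -> f x = 0) ->
  (V_sqnorm Omega (tensor y f) =
   (ell2_norm y ^+ 2)%:E * (\int[mu]_(x in Omega) (f x ^+ 2)%:E +
    \int[mu]_(x in Omega) (sqr_grad f x)%:E))%E.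
Proof.
move=> sf cK KO f0; rewrite /V_sqnorm /tensor sqr_ell2_norm.
under eq_eseriesr do rewrite H1_sqnorm_test//.
have := test_H1_lty sf cK KO f0; set S := (_ + _)%E => Soo.
have S0 : (0 <= S)%E.
  by rewrite adde_ge0//; apply: integral_ge0 => x _;
    rewrite lee_fin ?sqr_ge0 ?sqr_grad_ge0.
rewrite -(fineK (x := S)) ?ge0_fin_numE//.
under eq_eseriesr do rewrite muleC.
rewrite nneseriesZl; last by move=> i _; rewrite lee_fin sqnorm_ge0.
by rewrite muleC.
Qed.

Lemma tensor_in_V y f (K : set 'rV[R]_d) :
  smooth f -> compact K -> K `<=` Omega -> (forall x, ~ K x -> f x = 0) ->
  in_V Omega (tensor y f).
Proof.
move=> sf cK KO f0; split.
  by move=> i; apply: test_in_H10 => //; exact: test_functionZ f0.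
rewrite (V_sqnorm_tensor _ sf cK KO f0) lte_mul_pinfty ?lee_fin ?sqr_ge0//.
exact: test_H1_lty f0.
Qed.

Lemma V_partial_tensor k y f x : smooth f ->
  V_partial k (tensor y f) x = (partial k f x)%:C *: y.
Proof.
move=> sf; rewrite /V_partial.
have -> : (fun i => (tensor y f i).2 k x) = val ((partial k f x)%:C *: y).
  apply/funext => i; rewrite /tensor /= cpartialZ//.
  by rewrite mulrC.
by rewrite valKd.
Qed.

Lemma Re_V_form_tensor y f : smooth f ->
  complex.Re (V_form Omega C (tensor y f) (tensor y f)) =
  \int[mu]_(x in Omega) (sqr_grad f x * complex.Re (ell2_dot (C x y) y)).
Proof.
move=> sf; rewrite /V_form /cintegral /=; apply: eq_Rintegral => x _.
rewrite raddf_sum /sqr_grad mulr_suml; apply: eq_bigr => k _ /=.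
by rewrite V_partial_tensor// linearZZ; exact: Re_ell2_dotZ.
Qed.

Lemma integral_sqr_gt0 f a r : smooth f -> 0 < r -> cube a r `<=` Omega ->
  (forall x, cube a r x -> 0 < f x) ->
  (0 < \int[mu]_(x in Omega) (f x ^+ 2)%:E)%E.
Proof.
move=> sf r0 aO fp; rewrite lt_neqAle; apply/andP; split; last first.
  by apply: integral_ge0 => x _; rewrite lee_fin sqr_ge0.
apply/eqP => /esym int0.
have mf : measurable_fun Omega (fun x => (f x ^+ 2)%:E).
  by apply/measurable_EFinP; apply: measurable_funX; exact: smooth_measurable.
have : (\int[mu]_(x in Omega) `|(f x ^+ 2)%:E| = 0)%E.
  by rewrite -int0; apply: eq_integral => x _; rewrite gee0_abs// lee_fin sqr_ge0.
move=> /(ae_eq_integral_abs mu mO mf) aef.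
have /(negligibleP _ (measurable_cube a r)) : mu.-negligible (cube a r).
  apply: negligibleS aef => x ax /= /(_ (aO _ ax)) /eqP; rewrite eqe sqrf_eq0.
  by rewrite gt_eqF// fp.
move=> /=; rewrite lebesgue_cube// => /eqP; rewrite eqe expf_eq0.
by rewrite mulf_eq0 pnatr_eq0 /= gt_eqF// andbF.
Qed.

Lemma uniformly_coercive_of_coercive_form :
  poincare_type Omega -> class_C_closure Omega C -> accretive Omega C ->
  coercive_form Omega (V_form Omega C) -> uniformly_coercive Omega C.
Proof.
move=> [_ [c1 [c2 [c10 _ poi]]]] [_ contC] accC [a a0 Ca].
exists (a / 2) => [|x0 y Ox0]; first exact: divr_gt0.
have a20 : 0 < a / 2 by exact: divr_gt0.
set c := fun x => complex.Re (ell2_dot (C x y) y).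
rewrite -/(c x0); set n2 := ell2_norm y ^+ 2.
have n20 : 0 <= n2 by exact: sqr_ge0.
have [r [r0 rO rc]] : exists r, [/\ 0 < r, cube x0 (2 * r) `<=` Omega &
    forall x, cube x0 (2 * r) x -> c x <= c x0 + a / 2 * n2].
  have near_x0 : nbhs x0 (Omega `&` [set x | closure Omega x ->
      (opnorm (fun y => C x y - C x0 y)%R < (a / 2)%:E)%E]).
    apply: filterI; first exact: open_nbhs_nbhs.
    have := contC x0 (subset_closure Ox0).
    move=> /(_ [set z | (z < (a / 2)%:E)%E]); apply.
    by apply: (@nbhs_open_ereal_lt _ _ (fun=> a / 2)).
  have /nbhs_ballP[e /= e0 eO] := near_x0.
  have ee : 2 * (e / 2) = e by rewrite mulrC divfK ?pnatr_eq0.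
  exists (e / 2); rewrite ee -ball_rVE//; split.
  - exact: divr_gt0.
  - by move=> x /eO[].
  - move=> x /eO[Ox /(_ (subset_closure Ox)) /ltW opn].
    rewrite -lerBlDl /c -Re_ell2_dotB; apply: Re_ell2_dot_le => //.
    apply: (@opnorm_bound _ (fun z => C x z - C x0 z) _ y _ opn) => b z.
    by rewrite scalerBr; congr (_ - _); exact: linearZ.
have [f [sf fp f0]] := bump_exists x0 r.
(* The support of f is the closed cube K of radius r, which the cube of radius
   2 r, where C is controlled, contains together with its boundary. *)
pose K := [set x : 'rV[R]_d | forall i, `|x 0 i - x0 0 i| <= r].
have cK : compact K by exact: closed_cube_compact.
have Kcube : K `<=` cube x0 (2 * r).
  by move=> x Kx i; rewrite (le_lt_trans (Kx i))// ltr_pMl// ltr1n.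
have KO : K `<=` Omega by move=> x /Kcube /rO.
have cubeK : cube x0 r `<=` K by move=> x xr i; exact/ltW/xr.
have fK x : ~ K x -> f x = 0 by move=> Kx; apply: f0 => /cubeK.
have clK : closed K := compact_closed (@norm_hausdorff _ _) cK.
have gK x : ~ K x -> sqr_grad f x = 0.
  move=> Kx; rewrite /sqr_grad big1// => k _.
  by rewrite (partial_supp k clK fK Kx) expr0n.
set A := (\int[mu]_(x in Omega) (f x ^+ 2)%:E)%E.
set Q := (\int[mu]_(x in Omega) (sqr_grad f x)%:E)%E.
have Q0 : (0 <= Q)%E by apply: integral_ge0 => x _; rewrite lee_fin sqr_grad_ge0.
have Agt0 : (0 < A)%E.
  apply: (@integral_sqr_gt0 _ x0 r) => //.
  by move=> x xr; exact/KO/cubeK.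
have AQoo : (A + Q < +oo)%E := test_H1_lty sf cK KO fK.
have Qoo : (Q < +oo)%E.
  by apply: le_lt_trans AQoo; rewrite leeDr// ltW.
have Qfin : Q \is a fin_num by rewrite ge0_fin_numE.
(* The Poincare inequality forces the gradient of the bump to be nonzero *)
have Qgt0 : (0 < Q)%E.
  have tf := test_functionZ 1 sf cK KO fK.
  have Hf := test_in_H10 openO tf.
  have /andP[+ _] := poi _ Hf.
  rewrite Re_grad_dot; last by case: Hf.
  rewrite H1_sqnorm_test// sum_L2_sqnorm_partial// sqnormE /= expr1n expr0n addr0.
  rewrite !mul1e -/A -/Q; apply: lt_le_trans.
  by apply: mule_gt0; rewrite ?lte_fin//; apply: lt_le_trans Agt0 _; exact: leeDl.
have := Ca _ (tensor_in_V y sf cK KO fK).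
rewrite (V_sqnorm_tensor _ sf cK KO fK) -/n2 -/A -/Q Re_V_form_tensor//.
set b := c x0 + a / 2 * n2.
have b0 : 0 <= b by rewrite addr_ge0 ?accC// mulr_ge0// ltW.
have intc : (\int[mu]_(x in Omega) (sqr_grad f x * c x)%:E <= b%:E * Q)%E.
  rewrite -ge0_integralZl_EFin//; last 2 first.
  - by move=> x _; rewrite lee_fin sqr_grad_ge0.
  - exact: measurable_sqr_grad.
  apply: ge0_le_integral_nonmeasurable => x Ox.
    by rewrite lee_fin mulr_ge0 ?sqr_grad_ge0// accC.
  rewrite -EFinM lee_fin mulrC.
  have [Kx|/gK ->] := pselect (K x); last by rewrite !mulr0.
  by rewrite ler_wpM2r ?sqr_grad_ge0// rc//; exact: Kcube.
move=> H.
(* All integrals being finite, the estimates can be compared in \bar R. *)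
have {}H : (a%:E * (n2%:E * Q) <= b%:E * Q)%E.
  apply: (@le_trans _ _ (a%:E * (n2%:E * (A + Q)))%E).
    rewrite lee_pmul2l// lee_wpmul2l ?lee_fin// leeDr//; exact: ltW.
  apply: le_trans H _; rewrite /Rintegral fineK//.
  rewrite ge0_fin_numE; last first.
    by apply: integral_ge0 => x Ox; rewrite lee_fin mulr_ge0 ?sqr_grad_ge0// accC.
  by apply: le_lt_trans intc _; rewrite lte_mul_pinfty.
move: H; rewrite muleA -EFinM lee_pmul2r// lee_fin /b; lra.
Qed.

End necessity.

Theorem theorem13 (R : realType) (d : nat) (Omega : set 'rV[R]_d)
    (C : 'rV[R]_d -> {linear ell2 R -> ell2 R})
    (dom_Omega : is_domain Omega) (poincare_Omega : poincare_type Omega)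
    (cont_C : class_C_closure Omega C) (bounded_C : uniformly_bounded Omega C)
    (accretive_C : accretive Omega C) :
  coercive_form Omega (V_form Omega C) <-> uniformly_coercive Omega C.
Proof.
have [_ openO _] := dom_Omega; split.
- exact: uniformly_coercive_of_coercive_form.
- exact: coercive_form_of_uniformly_coercive.
Qed.
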